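(* Let $L(y,\mu)=\frac12(y-\mu)^2$. There exist positive constants $c$ and $C$, not depending on $n$, and $K$ pairwise disjoint index sets $\mathcal A_k\subseteq[p]$, $k=1,\dots,K$, such that if $s_w\ge2$, $s_w\le\frac25K$ and $\phi_n^2\le c\,\big(s_w^2\log(K/s_w)/n\big)^{1/3}$, then $$\inf_{\hat w}\ \sup_{Q\in\mathcal P^{1:n}_{Y,X}}\ \mathbb P_{(Y_i,X_i)\sim Q}\Big(\|\hat w-w^*\|_1\ge C s_w\sqrt{\frac{\log(K/s_w)}{\phi_n^2\,n}}\Big)\ge\frac12,$$ where the infimum is over all estimators $\hat w$ of $w^*$ based on $\{(Y_i,X_i)\}_{i=1}^n$.
   Context: $[N]=\{1,\dots,N\}$; $\|v\|_0$ is the number of nonzero entries of $v$; $v_S$ is the restriction of $v$ to $S$. Here $n,p,K,s_w$ are positive integers and $\phi_n>0$. For index sets $\mathcal A_1,\dots,\mathcal A_K\subseteq[p]$ and a distribution of $(Y_1,X_1)$, $X_1\in\mathbb R^p$, let $\beta^*_{(k)}=\operatorname{argmin}_{\beta\in\mathbb R^p,\beta_{\mathcal A_k^c}=0}\mathbb E L(Y_1,\langle\beta,X_1\rangle)$, $B^*=(\beta^*_{(1)},\dots,\beta^*_{(K)})$, $\mathcal W^K=\{w\in[0,1]^K:\sum_kw_k=1\}$, $w^*\in\operatorname{argmin}_{w\in\mathcal W^K}\mathbb E L(Y_1,\langle B^*w,X_1\rangle)$, and $S^*=\operatorname{supp}(w^* )$. For $S_*\subseteq[K]$ let $\mathbb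 C(S_*,w^* )=\{\Delta\in\mathcal W^K-w^*:\ \|\Delta_{S_*^c}\|_1-2\|w^*_{S_*^c}\|_1\le\|\Delta_{S_*}\|_1\}$ and $\phi^2(S_* )=\phi^2(S_*,B^*,w^* )=\min\{|S_*|\,\|B^*\Delta\|_2^2/\|\Delta_{S_*}\|_1^2:\Delta\in\mathbb C(S_*,w^* )\}$ (minimum/infimum over $\Delta$ with $\Delta_{S_*}\neq0$). With a fixed positive constant $C'$, the parameter space is $$\Theta=\Big\{(w^*,B^* ):\ \|w^*\|_0\le s_w,\ w^*\in\mathcal W^K,\ \max_{k\in[K]}\|\beta^*_{(k)}\|_2\le C',\ \phi^2(S^* )\ge\phi_n^2\Big\},$$ and $\mathcal P^{1:n}_{Y,X}$ is the class of distributions $Q$ such that $\{(Y_i,X_i)\}_{i=1}^n$ are i.i.d. from $Q$ with $Y_1\mid X_1\sim N(\sum_{j=1}^p\beta_jX_{1j},1)$, $X_1\sim N(0,I_p)$, and $(w^*,B^* )\in\Theta$.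
   Formalization: Adds K ≤ p (for p=1 w* is known and the claim fails) and s_w·sqrt(log(K/s_w)/(φ_n² n)) ≤ M for an arbitrary fixed M, with c, C depending on M and C' (as φ_n→0 the threshold exceeds 2, the largest possible ℓ1 error, and the claim fails). *)

(* Defs.v *)
(* MathComp / MathComp-Analysis *)
From HB Require Import structures.
From mathcomp Require Import all_boot all_order all_algebra.
From mathcomp Require Import all_classical all_reals all_analysis.
Set Implicit Arguments.
Unset Strict Implicit.
Unset Printing Implicit Defensive.
Import Order.TTheory GRing.Theory Num.Theory.
Import numFieldNormedType.Exports.
Local Open Scope classical_set_scope.
Local Open Scope ring_scope.

Section Vectors.
Context {R : realType}.

Definition supp K (v : 'cV[R]_K) : {set 'I_K} := [set k | v k 0 != 0].

Definition norm0 K (v : 'cV[R]_K) : nat := #|supp v|.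

Definition norm1_on K (S : {set 'I_K}) (v : 'cV[R]_K) : R :=
  \sum_(k in S) `|v k 0|.

Definition norm1 K (v : 'cV[R]_K) : R := \sum_k `|v k 0|.

Definition norm2 p (v : 'cV[R]_p) : R := Num.sqrt (\sum_j v j 0 ^+ 2).

Definition weights K : set 'cV[R]_K :=
  [set w | (forall k, 0 <= w k 0 <= 1) /\ \sum_k w k 0 = 1].

Definition argmin T (D : set T) (f : T -> \bar R) : set T :=
  [set x | D x /\ forall y, D y -> (f x <= f y)%E].

Definition cone K (S : {set 'I_K}) (w : 'cV[R]_K) : set 'cV[R]_K :=
  [set D | weights (w + D) /\
     norm1_on (~: S) D - 2 * norm1_on (~: S) w <= norm1_on S D].

(* The squared compatibility constant; +oo if every D in the cone vanishes on
   S. *)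
Definition phi2 p K (S : {set 'I_K}) (B : 'M[R]_(p, K)) (w : 'cV[R]_K)
    : \bar R :=
  ereal_inf [set (#|S|%:R * norm2 (B *m D) ^+ 2 / norm1_on S D ^+ 2)%:E
            | D in [set D | cone S w D /\ norm1_on S D != 0]].

Definition Theta p K (C' : R) (s : nat) (phin : R)
    (w : 'cV[R]_K) (B : 'M[R]_(p, K)) : Prop :=
  [/\ (norm0 w <= s)%N, weights w,
      forall k, norm2 (col k B) <= C' &
      ((phin ^+ 2)%:E <= phi2 (supp w) B w)%E].

End Vectors.

(* A law Q of one observation z = (Y, X) is a probability on
   R * p.-tuple R. *)
Section Model.
Context {R : realType}.

Definition inner p (b : 'cV[R]_p) (x : p.-tuple R) : R :=
  \sum_j b j 0 * tnth x j.

Definition sqloss (y mu : R) : R := 2^-1 * (y - mu) ^+ 2.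

Definition risk p (L : R -> R -> R) (Q : probability (R * p.-tuple R)%type R)
    (b : 'cV[R]_p) : \bar R :=
  'E_Q[fun z => L z.1 (inner b z.2)]%E.

Definition is_beta_star p K (L : R -> R -> R)
    (Q : probability (R * p.-tuple R)%type R)
    (A : 'I_K -> {set 'I_p}) (B : 'M[R]_(p, K)) : Prop :=
  forall k, argmin [set b : 'cV[R]_p | forall j, j \notin A k -> b j 0 = 0]
                   (risk L Q) (col k B).

Definition is_w_star p K (L : R -> R -> R)
    (Q : probability (R * p.-tuple R)%type R)
    (B : 'M[R]_(p, K)) (w : 'cV[R]_K) : Prop :=
  argmin (@weights R K) (fun v => risk L Q (B *m v)) w.

(* X ~ N(0, I_p): the coordinates are independent standard normal variables. *)
Definition std_gaussian_design p (Q : probability (R * p.-tuple R)%type R)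
    : Prop :=
  forall U : 'I_p -> set R, (forall j, measurable (U j)) ->
    Q [set z | forall j, U j (tnth z.2 j)] = (\prod_j normal_prob 0 1 (U j))%E.

(* Y | X ~ N(<b, X>, 1): x |-> N(<b, x>, 1) is a regular conditional
   distribution of Y given X. *)
Definition gaussian_response p (Q : probability (R * p.-tuple R)%type R)
    (b : 'cV[R]_p) : Prop :=
  forall (U : set R) (V : set (p.-tuple R)), measurable U -> measurable V ->
    Q (U `*` V) = (\int[Q]_(z in [set z | V z.2])
                     normal_prob (inner b z.2) 1 U)%E.

(* P is the joint law of n i.i.d. draws from Q, i.e. the product law of Q. *)
Definition iid_law n d (T : measurableType d) (Q : probability T R)
    (P : probability (n.-tuple T) R) : Prop :=
  forall U : 'I_n -> set T, (forall i, measurable (U i)) ->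
    P [set z | forall i, U i (tnth z i)] = (\prod_i Q (U i))%E.

Definition model_class p K (L : R -> R -> R) (A : 'I_K -> {set 'I_p})
    (C' : R) (s : nat) (phin : R) (Q : probability (R * p.-tuple R)%type R)
    (w : 'cV[R]_K) : Prop :=
  [/\ std_gaussian_design Q,
      exists b : 'cV[R]_p, gaussian_response Q b &
      exists B : 'M[R]_(p, K),
        [/\ is_beta_star L Q A B, is_w_star L Q B w & Theta C' s phin w B]].

Definition estimator n p K : set (n.-tuple (R * p.-tuple R) -> 'cV[R]_K) :=
  [set what | forall k, measurable_fun setT (fun z => what z k 0)].

(* The supremum also ranges over the target w, but w is a function of Q on the
   class: if the minimiser were not unique, the difference of two minimisers
   would lie in the cone and in the kernel of B, whence phi2 = 0. *)
Definition minimax_prob n p K (L : R -> R -> R) (A : 'I_K -> {set 'I_p})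
    (C' : R) (s : nat) (phin : R) (t : R) : \bar R :=
  ereal_inf [set
    ereal_sup [set r | exists (Q : probability (R * p.-tuple R)%type R)
                              (P : probability (n.-tuple (R * p.-tuple R)) R)
                              (w : 'cV[R]_K),
       [/\ model_class L A C' s phin Q w, iid_law Q P &
           r = P [set z | t <= norm1 (what z - w)]]]
  | what in @estimator n p K].

Definition rate (n K s : nat) (phin : R) : R :=
  s%:R * Num.sqrt (ln (K%:R / s%:R) / (phin ^+ 2 * n%:R)).

End Model.

(* Main.v *)
Require Import Defs.
From HB Require Import structures.
From mathcomp Require Import all_boot all_order all_algebra.
From mathcomp Require Import all_classical all_reals all_analysis.
From mathcomp Require Import measurable_realfun ring lra zify.
Set Implicit Arguments.
Unset Strict Implicit.
Unset Printing Implicit Defensive.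
Import Order.TTheory GRing.Theory Num.Theory.
Import numFieldNormedType.Exports.
Local Open Scope classical_set_scope.
Local Open Scope ring_scope.

(* Take singletons A_k = {e_k} and the true coefficients
   beta_k = phi / sqrt (1 - w_k), for a prescribed w in the simplex. Then B* is
   diagonal, the excess risk of v is sum_k beta_k^2 (1 - v_k)^2 / 2, and since
   beta_k^2 (1 - w_k) = phi^2 for every k, w is the minimiser; moreover
   beta_k^2 >= phi^2 gives the compatibility condition.

   Let w put mass 1 - eta on one coordinate and eta / r on one coordinate of
   each of r = s / 2 disjoint blocks of size m = (K - 1) / r, with eta
   proportional to the rate. The largest coefficient is phi / sqrt eta, and
   phi / sqrt eta <= C' is where phi^2 <= c (s^2 log (K / s) / n)^(1/3) is
   needed.
   Two such w are at l1-distance at least eta / r times the number of blocks in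
   which they differ.

   All these laws are compared with the law P0 whose coefficients come from the
   sub-probability weights (1 - eta, 0, ..., 0). The squared distance of the
   coefficients is at most phi^2 eta^2 / r, so that the chi-square divergence
   from P0 is at most a small power of m^r. For c > 1,
   P(S) <= c P0(S) + chi2 / (4 (c - 1)); averaging this over the m^r choices of
   coordinates, with S the event that the estimator is close to w, and using
   that only few of the w can be close to a given point, gives error probability
   at least 1/2. *)

(** * Standard normal variables *)

Section StandardNormal.
Local Open Scope ereal_scope.
Context {R : realType}.
Implicit Types (f : R -> \bar R) (h : R).

Local Notation N := (normal_prob (0 : R) 1).
Local Notation mu := (@lebesgue_measure R).

(** The Radon-Nikodym derivative of the normal law and [normal_pdf] have the same integral over
    every measurable set, so they agree almost everywhere. *)
Lemma ge0_integral_normal (m s : R) f :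
  measurable_fun setT f -> (forall x, 0 <= f x) ->
  \int[normal_prob m s]_x f x = \int[mu]_x (f x * (normal_pdf m s x)%:E).
Proof.
move=> mf f0; have dom := normal_prob_dominates m s.
have mpdf : measurable_fun setT (fun x => (normal_pdf m s x)%:E).
  by apply/measurable_EFinP; exact: measurable_normal_pdf.
pose g := Radon_Nikodym_SigmaFinite.f (normal_prob m s) mu.
have g_int : mu.-integrable setT g.
  exact: Radon_Nikodym_SigmaFinite.f_integrable.
rewrite -(Radon_Nikodym_SigmaFinite.change_of_variables dom f0 measurableT mf).
apply: ge0_ae_eq_integral => //.
- by apply: emeasurable_funM => //; exact: (measurable_int mu).
- exact: emeasurable_funM.
- by move=> x _; rewrite mule_ge0// Radon_Nikodym_SigmaFinite.f_ge0.
- by move=> x _; rewrite mule_ge0// lee_fin normal_pdf_ge0.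
apply: ae_eqe_mul2l; apply: integral_ae_eq => // E _ mE.
by rewrite -Radon_Nikodym_SigmaFinite.f_integral.
Qed.

(** The image of Lebesgue measure under a shift gives half-open intervals their length, and this
    determines the measure. *)
Lemma ge0_integral_translate f h : measurable_fun setT f ->
  (forall x, 0 <= f x) -> \int[mu]_x f (x + h)%R = \int[mu]_x f x.
Proof.
move=> mf f0.
have mh : measurable_fun setT 
    (fun x : measurableTypeR R => (x + h)%R : measurableTypeR R).
  exact: measurable_funD.
rewrite -[LHS](ge0_integral_pushforward mh mu measurableT mf)//.
apply: eq_measure_integral => A mA _.
apply/esym; apply: lebesgue_measure_unique => //= _ [[a b]] _ <-.
rewrite /pushforward.
have -> : (fun x => (x + h)%R) @^-1` [set` `]a, b]] =
    [set` `](a - h)%R, (b - h)%R]].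
  apply/seteqP; split => x /=; rewrite !in_itv/= ltrBlDr lerBrDr; done.
rewrite !lebesgue_measure_itv/= !lte_fin ltrD2r.
by case: ifP => // _; rewrite -!EFinB; congr EFin; rewrite opprB addrA subrK.
Qed.

Lemma ge0_integral_opp f : measurable_fun setT f ->
  (forall x, 0 <= f x) -> \int[N]_x f (- x)%R = \int[N]_x f x.
Proof.
move=> mf f0.
have mfN : measurable_fun setT (fun x : R => f (- x)%R).
  by apply: measurableT_comp => //; exact: measurable_funN.
rewrite !ge0_integral_normal//.
transitivity (\int[mu]_x (fun x => f x * (normal_pdf 0 1 x)%:E) (- x)%R).
  apply: eq_integral => x _ /=; congr (_ * _%:E).
  by rewrite !normal_pdfE ?oner_eq0// /normal_fun !subr0 sqrrN.
set F := (fun x => f x * (normal_pdf 0 1 x)%:E).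
have mF : measurable_fun setT F.
  apply: emeasurable_funM => //; apply/measurable_EFinP.
  exact: measurable_normal_pdf.
have F0 x : 0 <= F x by rewrite mule_ge0// lee_fin normal_pdf_ge0.
have mN : measurable_fun setT (-%R : measurableTypeR R -> measurableTypeR R).
  exact: measurable_funN.
rewrite -[LHS](ge0_integral_pushforward mN mu measurableT mF)//.
by apply: eq_measure_integral => A mA _; exact: lebesgue_measureN.
Qed.


Lemma ge0_integral_normal_shift f h : measurable_fun setT f ->
  (forall x, 0 <= f x) ->
  \int[normal_prob h 1]_x f x = \int[N]_x f (x + h)%R.
Proof.
move=> mf f0.
have mfh : measurable_fun setT (fun x : R => f (x + h)%R).
  by apply: measurableT_comp => //; exact: measurable_funD.
rewrite (ge0_integral_normal h 1 mf f0).
rewrite (ge0_integral_normal 0 1 mfh); last by move=> x; exact: f0.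
rewrite -[LHS](ge0_integral_translate h); last 2 first.
- apply: emeasurable_funM => //; apply/measurable_EFinP.
  exact: measurable_normal_pdf.
- by move=> x; rewrite mule_ge0// lee_fin normal_pdf_ge0.
apply: eq_integral => x _; congr (_ * _%:E).
by rewrite !normal_pdfE ?oner_eq0// /normal_fun addrK subr0.
Qed.

Lemma normal_prob_shift h (U : set R) : measurable U ->
  normal_prob h 1 U = N [set x | U (x + h)%R].
Proof.
move=> mU.
have := @ge0_integral_normal_shift (EFin \o \1_U) h.
rewrite /= integral_indic// setIT => -> //; last first.
- by apply/measurable_EFinP; exact: measurable_indic.
have mV : measurable [set x : R | U (x + h)%R].
  have : measurable_fun setT (fun x : R => (x + h)%R) by exact: measurable_funD.
  by move=> /(_ measurableT _ mU); rewrite setTI.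
have <- : \int[N]_x (\1_[set x : R | U (x + h)%R] x)%:E =
    N [set x | U (x + h)%R].
  by rewrite integral_indic// setIT.
by apply: eq_integral => x _; rewrite !indicE.
Qed.

(** The Cameron-Martin formula: the exponential factor is the density of N(h, 1) relative to N(0,
    1). *)
Lemma ge0_integral_normal_translate f h : measurable_fun setT f ->
  (forall x, 0 <= f x) ->
  \int[N]_x f (x + h)%R = \int[N]_x (f x * (expR (h * x - h ^+ 2 / 2))%:E).
Proof.
move=> mf f0.
pose g x := f x * (expR (h * x - h ^+ 2 / 2))%:E.
have mg : measurable_fun setT g.
  apply: emeasurable_funM => //; apply/measurable_EFinP.
  apply: measurableT_comp => //.
  by apply: measurable_funD => //; apply: measurable_funM.
have g0 x : 0 <= g x by rewrite mule_ge0// lee_fin expR_ge0.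
rewrite -(ge0_integral_normal_shift h mf f0) (ge0_integral_normal h 1 mf f0).
rewrite (ge0_integral_normal 0 1 mg g0).
apply: eq_integral => x _; rewrite -muleA -EFinM; congr (_ * _%:E).
rewrite !normal_pdfE ?oner_eq0// /normal_fun subr0.
rewrite mulrCA -expRD; congr (_ * expR _)%R.
by field.
Qed.

(** Translating the constant 1 shows that exp(hx - h^2/2) integrates to 1. *)
Lemma normal_mgf h : \int[N]_x (expR (h * x))%:E = (expR (h ^+ 2 / 2))%:E.
Proof.
have /= := @ge0_integral_normal_translate (cst 1) h.
rewrite integral_cst//= mul1e probability_setT =>
  /(_ (measurable_cst _) (fun=> lee01)).
under [X in _ = X -> _]eq_integral do rewrite mul1e expRD EFinM.
rewrite ge0_integralZr//=.
- move=> H; rewrite -[LHS]mule1.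
  rewrite [X in _ * X](_ : 1 =
    (expR (- (h ^+ 2 / 2)))%:E * (expR (h ^+ 2 / 2))%:E).
    by rewrite muleA -H mul1e.
  by rewrite -EFinM -expRD addNr expR0.
- by apply/measurable_EFinP; apply: measurableT_comp.
Qed.

(** The integrand times the standard normal density is s times the density of N(0, s^2), where s =
    (1 - 2c)^(-1/2). *)
Lemma normal_sqr_mgf (c : R) : (c < 2^-1)%R ->
  \int[N]_x (expR (c * x ^+ 2))%:E = ((Num.sqrt (1 - 2 * c))^-1)%:E.
Proof.
move=> c2; have D0 : (0 < 1 - 2 * c)%R by lra.
set s := ((Num.sqrt (1 - 2 * c))^-1)%R.
have s0 : (0 < s)%R by rewrite invr_gt0 sqrtr_gt0.
have s2 : (s ^+ 2 = (1 - 2 * c)^-1)%R by rewrite exprVn sqr_sqrtr// ltW.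
rewrite (@ge0_integral_normal 0 1); last 2 first.
- apply/measurable_EFinP; apply: measurableT_comp => //.
  by apply: measurable_funM => //; exact: measurable_funX.
- by move=> x; rewrite lee_fin expR_ge0.
transitivity (\int[mu]_x (s%:E * (normal_pdf 0 s x)%:E)).
  apply: eq_integral => x _; rewrite -!EFinM; congr EFin.
  rewrite !normal_pdfE ?oner_eq0 ?gt_eqF// /normal_peak /normal_fun subr0.
  rewrite mulrCA -expRD [RHS]mulrA; congr (_ * expR _)%R; last first.
    rewrite s2 expr1n -[((1 - 2 * c)^-1 *+ 2)%R]mulr_natr invfM invrK.
    by move: (x : R) => y; field.
  rewrite expr1n mul1r -mulrnAr sqrtrM ?sqr_ge0// sqrtr_sqr gtr0_norm//.
  by rewrite invfM mulrA divff ?mul1r// gt_eqF.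
rewrite ge0_integralZl//.
- by rewrite integral_normal_pdf mule1.
- by apply/measurable_EFinP; exact: measurable_normal_pdf.
- by move=> x _; rewrite lee_fin normal_pdf_ge0.
- by rewrite lee_fin ltW.
Qed.

(** Averaging over x and -x removes the cross term 2abx, so that only nonnegative functions are
    integrated. The second moment stays symbolic. *)
Lemma normal_affine_sqr (a b : R) :
  \int[N]_x ((a + b * x) ^+ 2)%:E =
  (a ^+ 2)%:E + (b ^+ 2)%:E * \int[N]_x (x ^+ 2)%:E.
Proof.
have m1 (u v : R) : measurable_fun setT (fun x : R => ((u + v * x) ^+ 2)%:E).
  apply/measurable_EFinP; apply: measurable_funX.
  by apply: measurable_funD => //; exact: measurable_funM.
have p1 (u v x : R) : 0 <= ((u + v * x) ^+ 2)%:E by rewrite lee_fin sqr_ge0.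
have msq : measurable_fun setT (fun x : R => (x ^+ 2)%:E).
  by apply/measurable_EFinP; exact: measurable_funX.
set I := \int[N]_x ((a + b * x) ^+ 2)%:E.
have I2 : I = \int[N]_x ((a - b * x) ^+ 2)%:E.
  rewrite /I -[LHS](ge0_integral_opp (m1 _ _) (p1 _ _)).
  by apply: eq_integral => x _; rewrite mulrN.
have : I + I = 2%:E * ((a ^+ 2)%:E + (b ^+ 2)%:E * \int[N]_x (x ^+ 2)%:E).
  rewrite {2}I2 /I -ge0_integralD//; last 2 first.
    by move=> x _; rewrite lee_fin sqr_ge0.
    by under eq_fun do rewrite -mulNr; exact: m1.
  transitivity (\int[N]_x ((2 * a ^+ 2)%:E + (2 * b ^+ 2)%:E * (x ^+ 2)%:E)).
    by apply: eq_integral => x _; rewrite -EFinM -!EFinD; congr EFin; ring.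
  rewrite ge0_integralD//=.
  - rewrite integral_cst//= probability_setT mule1 ge0_integralZl//=.
    + move: (\int[N]_x (x ^+ 2)%:E) => v.
      by rewrite muleDr ?fin_num_adde_defr// muleA -!EFinM.
    + by move=> x _; rewrite lee_fin sqr_ge0.
    + by rewrite lee_fin mulr_ge0 ?sqr_ge0.
  - by move=> x _; rewrite lee_fin mulr_ge0 ?sqr_ge0.
  - by move=> x _; apply: mule_ge0; rewrite lee_fin ?sqr_ge0// mulr_ge0 ?sqr_ge0.
  - exact: emeasurable_funM.
  - exact: m1.
have -> : I + I = 2%:E * I by rewrite mule_natl mule2n.
move=> /(congr1 (fun z => (2^-1)%:E * z)).
by rewrite !muleA -EFinM mulVf// !mul1e.
Qed.

End StandardNormal.

(** * Product laws and change of measure *)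

Section TupleProduct.
Local Open Scope ereal_scope.
Context {d} {T : measurableType d} {R : realType}.

Definition tuple_of_pair n (z : T * n.-tuple T) : n.+1.-tuple T :=
  [tuple of z.1 :: z.2].

Lemma measurable_tuple_of_pair n : measurable_fun setT (@tuple_of_pair n).
Proof. exact: measurable_cons. Qed.

HB.instance Definition _ n :=
  isMeasurableFun.Build _ _ _ _ (@tuple_of_pair n) (@measurable_tuple_of_pair n).

(** The recursion lets Tonelli peel off one coordinate at a time. It serves both for the coordinates
    of the design and for the sample. *)
Fixpoint iid_prob (Q : probability T R) n : probability (n.-tuple T) R :=
  if n is n'.+1 then distribution (Q \x iid_prob Q n') (@tuple_of_pair n')
  else dirac [tuple].

Lemma ge0_integral_iid_prob0 Q (f : 0.-tuple T -> \bar R) :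
  measurable_fun setT f -> \int[iid_prob Q 0]_x f x = f [tuple].
Proof. by move=> mf; rewrite integral_dirac//= diracT mul1e. Qed.

Lemma ge0_integral_iid_probS Q n (f : n.+1.-tuple T -> \bar R) :
  measurable_fun setT f -> (forall x, 0 <= f x) ->
  \int[iid_prob Q n.+1]_x f x =
  \int[Q]_t \int[iid_prob Q n]_s f (tuple_of_pair (t, s)).
Proof.
move=> mf f0; rewrite ge0_integral_distribution//=.
rewrite fubini_tonelli1//=.
by apply: measurableT_comp => //; exact: measurable_tuple_of_pair.
Qed.

Lemma measurable_tuple_box n (U : 'I_n -> set T) :
  (forall i, measurable (U i)) ->
  measurable [set s : n.-tuple T | forall i, U i (tnth s i)].
Proof.
move=> mU.
have -> : [set s : n.-tuple T | forall i, U i (tnth s i)] =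
          \bigcap_(i in [set: 'I_n]) ((@tnth n T ^~ i) @^-1` U i).
  by apply/seteqP; split=> [s /= H i _|s /= H i]; exact: H.
apply: fin_bigcap_measurable => // i _.
by rewrite -[X in measurable X]setTI; exact: measurable_tnth.
Qed.

Lemma iid_law_iid_prob (Q : probability T R) n : iid_law Q (iid_prob Q n).
Proof.
elim: n => [|n IH] U mU.
  rewrite big_ord0 /= diracE mem_set//= => -[]//.
rewrite big_ord_recl /= /distribution/= /pushforward.
rewrite -IH// -product_measure1E//.
- congr (_ _); apply/seteqP; split=> [[t s]/= H|[t s]/= [H1 H2] i].
  - split=> /=; first exact: (H ord0).
    by move=> i; have := H (lift ord0 i); rewrite tnthS.
  - case: (unliftP ord0 i) => [j ->|->]; last exact: H1.
    by rewrite tnthS; exact: H2.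
- by apply: (@measurable_tuple_box n (fun i => U (lift ord0 i))) => i.
Qed.

End TupleProduct.

Section Likelihood.
Local Open Scope ereal_scope.
Context {d} {T : measurableType d} {R : realType}.
Variables (Q0 Q1 : probability T R) (l : T -> R).
Hypothesis ml : measurable_fun setT l.
Hypothesis l0 : forall t, (0 <= l t)%R.
Hypothesis Q1E : forall f : T -> \bar R, measurable_fun setT f ->
  (forall t, 0 <= f t) -> \int[Q1]_t f t = \int[Q0]_t (f t * (l t)%:E).

Definition likelihood n (s : n.-tuple T) : R := \prod_(i < n) l (tnth s i).

Lemma likelihood_ge0 n (s : n.-tuple T) : (0 <= likelihood s)%R.
Proof. exact: prodr_ge0. Qed.

Lemma measurable_likelihood n : measurable_fun setT (@likelihood n).
Proof.
apply: (@measurable_prod _ _ _ _ _ _ (fun i (s : n.-tuple T) => l (tnth s i))).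
move=> i _; apply: (@measurableT_comp _ _ _ _ _ _ l) => //.
exact: measurable_tnth.
Qed.

Lemma likelihoodS n t (s : n.-tuple T) :
  likelihood (tuple_of_pair (t, s)) = (l t * likelihood s)%R.
Proof.
rewrite /likelihood big_ord_recl; congr (_ * _)%R.
by apply: eq_bigr => i _; rewrite tnthS.
Qed.

Lemma ge0_integral_likelihood n (f : n.-tuple T -> \bar R) :
  measurable_fun setT f -> (forall s, 0 <= f s) ->
  \int[iid_prob Q1 n]_s f s =
  \int[iid_prob Q0 n]_s (f s * (likelihood s)%:E).
Proof.
elim: n f => [|n IH] f mf f0.
  rewrite !ge0_integral_iid_prob0 ?[likelihood _]big_ord0 ?mule1//.
  apply: emeasurable_funM => //; apply/measurable_EFinP.
  exact: measurable_likelihood.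
have mfL : measurable_fun setT (fun s => f s * (likelihood s)%:E).
  apply: emeasurable_funM => //; apply/measurable_EFinP.
  exact: measurable_likelihood.
have mft : measurable_fun setT (f \o @tuple_of_pair _ T n).
  by apply: measurableT_comp => //; exact: measurable_tuple_of_pair.
have mt t : measurable_fun setT (fun s : n.-tuple T => tuple_of_pair (t, s)).
  by apply: (@measurable_cons _ _ _ _ (fun=> t) n id).

rewrite !ge0_integral_iid_probS//; last first.
  by move=> s; rewrite mule_ge0// lee_fin likelihood_ge0.
rewrite Q1E; last 2 first.
  have H : measurable_fun setT
      (fubini_F (iid_prob Q1 n) (f \o @tuple_of_pair _ T n)).
    by apply: measurable_fun_fubini_tonelli_F => // z; exact: f0.
  exact: H.
- by move=> t; apply: integral_ge0.
apply: eq_integral => t _.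
rewrite IH//; last exact: measurableT_comp.
rewrite -ge0_integralZr//.
- by apply: eq_integral => s _; rewrite likelihoodS EFinM muleAC muleA.
- apply: emeasurable_funM; first exact: measurableT_comp.
  by apply/measurable_EFinP; exact: measurable_likelihood.
- by move=> s _; rewrite mule_ge0// lee_fin likelihood_ge0.
- by rewrite lee_fin.
Qed.

(** Here [a] is one plus the chi-square divergence of [Q1] from [Q0]; this quantity is
    multiplicative over independent draws. *)
Lemma integral_likelihood_sqr n (a : R) :
  \int[Q0]_t ((l t) ^+ 2)%:E = a%:E ->
  \int[iid_prob Q0 n]_s ((likelihood s) ^+ 2)%:E = (a ^+ n)%:E.
Proof.
move=> aE.
have mL2 k : measurable_fun setT
    (fun s : k.-tuple T => ((likelihood s) ^+ 2)%:E).
  apply/measurable_EFinP; apply: measurable_funX.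
  exact: measurable_likelihood.
elim: n => [|n IH].
  by rewrite ge0_integral_iid_prob0// /likelihood big_ord0 expr1n expr0.
rewrite ge0_integral_iid_probS//; last by move=> s; rewrite lee_fin sqr_ge0.
transitivity (\int[Q0]_t (((l t) ^+ 2)%:E * (a ^+ n)%:E)).
  apply: eq_integral => t _.
  under eq_integral do rewrite likelihoodS exprMn EFinM.
  rewrite ge0_integralZl//= ?IH//.
  - exact: mL2.
  - by move=> s _; rewrite lee_fin sqr_ge0.
  - by rewrite lee_fin sqr_ge0.
rewrite ge0_integralZr//.
- by rewrite aE -EFinM exprS.
- by apply/measurable_EFinP; exact: measurable_funX.
- by move=> t _; rewrite lee_fin sqr_ge0.
- rewrite lee_fin exprn_ge0// -lee_fin -aE integral_ge0// => t _.
  by rewrite lee_fin sqr_ge0.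
Qed.

(* On A the likelihood L is at most
   c + (L - c)_+ <= c + (L - 1)^2 / (4 (c - 1)). *)
Lemma chi2_change_of_measure n (a c : R) (A : set (n.-tuple T)) :
  \int[Q0]_t ((l t) ^+ 2)%:E = a%:E -> (1 < c)%R -> measurable A ->
  (fine (iid_prob Q1 n A) <=
   c * fine (iid_prob Q0 n A) + (a ^+ n - 1) / (4 * (c - 1)))%R.
Proof.
move=> aE c1 mA.
have k0 : (0 <= 4 * (c - 1))%R by lra.
have mL : measurable_fun setT (fun s : n.-tuple T => (likelihood s)%:E).
  by apply/measurable_EFinP; exact: measurable_likelihood.
have mL2 : measurable_fun setT (fun s : n.-tuple T => ((likelihood s) ^+ 2)%:E).
  apply/measurable_EFinP; apply: measurable_funX.
  exact: measurable_likelihood.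
have m1A : measurable_fun setT (fun s : n.-tuple T => (\1_A s : R)%:E).
  by apply/measurable_EFinP; exact: measurable_indic.
have P1A : iid_prob Q1 n A =
    \int[iid_prob Q0 n]_s ((\1_A s)%:E * (likelihood s)%:E).
  rewrite -ge0_integral_likelihood//.
  by rewrite integral_indic// setIT.
have P1T : \int[iid_prob Q0 n]_s (likelihood s)%:E = 1.
  transitivity (\int[iid_prob Q1 n]_s cst 1 s).
    rewrite ge0_integral_likelihood//.
    by apply: eq_integral => s _; rewrite mul1e.
  by rewrite integral_cst// mul1e; exact: (probability_setT (iid_prob Q1 n)).
have P0A : iid_prob Q0 n A = \int[iid_prob Q0 n]_s (\1_A s)%:E.
  by rewrite integral_indic// setIT.
(* This is the pointwise bound times 4(c - 1), rearranged to have nonnegative integrands on both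
   sides. The gap is (L - 1 - 2(c - 1))^2 on A and (L - 1)^2 off A. *)
have ineq :
  \int[iid_prob Q0 n]_s
    ((4 * (c - 1))%:E * ((\1_A s)%:E * (likelihood s)%:E) + 2%:E * (likelihood s)%:E) <=
            \int[iid_prob Q0 n]_s ((4 * (c - 1) * c)%:E * (\1_A s)%:E +
                                   (((likelihood s) ^+ 2)%:E + 1)).
  apply: ge0_le_integral => //.
  - move=> s _; rewrite -!EFinM -EFinD lee_fin.
    have L0 := likelihood_ge0 s; apply: addr_ge0; last exact: mulr_ge0.
    by apply: mulr_ge0 => //; exact: mulr_ge0.
  - apply: emeasurable_funD; apply: emeasurable_funM => //.
    exact: emeasurable_funM.
  - apply: emeasurable_funD; first exact: emeasurable_funM.
    exact: emeasurable_funD.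
  - move=> s _; rewrite -!EFinM -!EFinD lee_fin.
    rewrite indicE; move: (likelihood s) => L.
    case: (s \in A); rewrite ?mulr1n ?mulr0n.
      by have := sqr_ge0 (L - 1 - 2 * (c - 1))%R; nra.
    by have := sqr_ge0 (L - 1)%R; nra.
have L0 s : 0 <= (likelihood s)%:E by rewrite lee_fin likelihood_ge0.
have I0 s : 0 <= (\1_A s : R)%:E by rewrite lee_fin.
have IL0 (s : n.-tuple T) : 0 <= (\1_A s)%:E * (likelihood s)%:E.
  exact: mule_ge0.
have mIL : measurable_fun setT
    (fun s : n.-tuple T => (\1_A s)%:E * (likelihood s)%:E).
  exact: emeasurable_funM.
have S0 (s : n.-tuple T) : 0 <= ((likelihood s) ^+ 2)%:E.
  by rewrite lee_fin sqr_ge0.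
have k0E : 0 <= (4 * (c - 1))%:E by rewrite lee_fin.
have kc0E : 0 <= (4 * (c - 1) * c)%:E by rewrite lee_fin mulr_ge0//; lra.
have E1 :
  \int[iid_prob Q0 n]_s
    ((4 * (c - 1))%:E * ((\1_A s)%:E * (likelihood s)%:E) + 2%:E * (likelihood s)%:E) =
          (4 * (c - 1))%:E * iid_prob Q1 n A + 2%:E.
  rewrite ge0_integralD//.
  - by rewrite !ge0_integralZl// -P1A P1T mule1.
  - by move=> s _; exact: mule_ge0.
  - exact: emeasurable_funM.
  - by move=> s _; exact: mule_ge0.
  - exact: emeasurable_funM.
have E2 : \int[iid_prob Q0 n]_s ((4 * (c - 1) * c)%:E * (\1_A s)%:E +
                                   (((likelihood s) ^+ 2)%:E + 1)) =
          (4 * (c - 1) * c)%:E * iid_prob Q0 n A + ((a ^+ n)%:E + 1).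
  rewrite ge0_integralD//.
  - rewrite ge0_integralZl// -P0A ge0_integralD// (integral_likelihood_sqr _ aE).
    rewrite integral_cst// mul1e; congr (_ + (_ + _)).
    exact: (probability_setT (iid_prob Q0 n)).
  - by move=> s _; exact: mule_ge0.
  - exact: emeasurable_funM.
  - by move=> s _; exact: adde_ge0.
  - exact: emeasurable_funD.
move: ineq; rewrite E1 E2.
rewrite -(fineK (fin_num_measure (iid_prob Q1 n) _ mA)).
rewrite -(fineK (fin_num_measure (iid_prob Q0 n) _ mA)) /=.
rewrite -?EFinM -?EFinD lee_fin.
move: (fine _) (fine _) => x y H.
rewrite -lerBlDl ler_pdivlMr; last by lra.
by lra.
Qed.

End Likelihood.

(** * Gaussian vectors and the regression law *)

Lemma integral_probability_cst d (T : measurableType d) (R : realType)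
  (P : probability T R) (c : \bar R) : (\int[P]_x c = c)%E.
Proof. by rewrite integral_cst// [X in (_ * X)%E](probability_setT P) mule1. Qed.

Section StdNormal.
Local Open Scope ereal_scope.
Context {R : realType}.

Definition toR (x : measurableTypeR R) : R := x.

Lemma measurable_toR : measurable_fun setT toR.
Proof. by move=> _ Y mY; rewrite setTI. Qed.

HB.instance Definition _ :=
  isMeasurableFun.Build _ _ _ _ toR measurable_toR.

(* The library's normal_prob lives on measurableTypeR R, whose display differs
   from that of R. *)
Definition stdnormal : probability R R := distribution (normal_prob 0 1) toR.

Lemma stdnormalE (A : set R) : stdnormal A = normal_prob 0 1 A.
Proof. by []. Qed.

Lemma ge0_integral_stdnormal (f : R -> \bar R) : measurable_fun setT f ->
  (forall x, 0 <= f x) -> \int[stdnormal]_x f x = \int[normal_prob 0 1]_x f x.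
Proof. by move=> mf f0; rewrite ge0_integral_distribution. Qed.

Lemma measurable_expR_lin (a : R) :
  measurable_fun setT (fun x : R => (expR (a * x))%:E).
Proof.
by apply/measurable_EFinP; apply: measurableT_comp.
Qed.

Lemma stdnormal_mgf (h : R) :
  \int[stdnormal]_x (expR (h * x))%:E = (expR (h ^+ 2 / 2))%:E.
Proof.
rewrite ge0_integral_stdnormal; first exact: normal_mgf.
- exact: measurable_expR_lin.
- by move=> x; rewrite lee_fin expR_ge0.
Qed.

Lemma stdnormal_sqr_mgf (c : R) : (c < 2^-1)%R ->
  \int[stdnormal]_x (expR (c * x ^+ 2))%:E = ((Num.sqrt (1 - 2 * c))^-1)%:E.
Proof.
move=> c2; rewrite ge0_integral_stdnormal; first exact: normal_sqr_mgf.
- apply/measurable_EFinP; apply: measurableT_comp => //.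
  by apply: measurable_funM => //; exact: measurable_funX.
- by move=> x; rewrite lee_fin expR_ge0.
Qed.

Lemma stdnormal_affine_sqr (a b : R) :
  \int[stdnormal]_x ((a + b * x) ^+ 2)%:E =
  (a ^+ 2)%:E + (b ^+ 2)%:E * \int[stdnormal]_x (x ^+ 2)%:E.
Proof.
rewrite !ge0_integral_stdnormal; first exact: normal_affine_sqr.
- by apply/measurable_EFinP; exact: measurable_funX.
- by move=> x; rewrite lee_fin sqr_ge0.
- apply/measurable_EFinP; apply: measurable_funX.
  by apply: measurable_funD => //; exact: measurable_funM.
- by move=> x; rewrite lee_fin sqr_ge0.
Qed.

Lemma ge0_integral_stdnormal_translate (f : R -> \bar R) h :
  measurable_fun setT f -> (forall x, 0 <= f x) ->
  \int[stdnormal]_x f (x + h)%R =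
  \int[stdnormal]_x (f x * (expR (h * x - h ^+ 2 / 2))%:E).
Proof.
move=> mf f0; rewrite !ge0_integral_stdnormal.
- exact: ge0_integral_normal_translate.
- apply: emeasurable_funM => //; apply/measurable_EFinP.
  apply: measurableT_comp => //.
  by apply: measurable_funD => //; apply: measurable_funM.
- by move=> x; rewrite mule_ge0// lee_fin expR_ge0.
- by apply: measurableT_comp => //; exact: measurable_funD.
- by move=> x; exact: f0.
Qed.

End StdNormal.

Section GaussianVector.
Local Open Scope ereal_scope.
Context {R : realType}.

Local Notation N := (@stdnormal R).

Definition std_gaussian p : probability (p.-tuple R) R :=
  iid_prob N p.

Definition lin p (d : 'I_p -> R) (x : p.-tuple R) : R := \sum_j d j * tnth x j.

Lemma measurable_lin p (d : 'I_p -> R) : measurable_fun setT (lin d).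
Proof.
apply: (@measurable_sum _ _ _ _ _ _
  (fun j (x : p.-tuple R) => d j * tnth x j)%R) => j.
by apply: measurable_funM => //; exact: measurable_tnth.
Qed.

Lemma linS p (d : 'I_p.+1 -> R) t x :
  lin d (tuple_of_pair (t, x)) = (d ord0 * t + lin (d \o lift ord0) x)%R.
Proof.
rewrite /lin big_ord_recl; congr (_ + _)%R.
by apply: eq_bigr => i _; rewrite tnthS.
Qed.

(** The constant [a] carries the induction on p: once the first coordinate is fixed, its
    contribution is absorbed into [a]. *)
Lemma std_gaussian_affine_sqr p (a : R) (d : 'I_p -> R) :
  \int[std_gaussian p]_x ((a + lin d x) ^+ 2)%:E =
  (a ^+ 2)%:E + (\sum_j d j ^+ 2)%:E * \int[N]_x (x ^+ 2)%:E.
Proof.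
have m1 k (u : R) (e : 'I_k -> R) :
    measurable_fun setT (fun x => ((u + lin e x) ^+ 2)%:E).
  apply/measurable_EFinP; apply: measurable_funX.
  by apply: measurable_funD => //; exact: measurable_lin.
have v0 : 0 <= \int[N]_x (x ^+ 2)%:E.
  by apply: integral_ge0 => x _; rewrite lee_fin sqr_ge0.
elim: p a d => [|p IH] a d.
  rewrite ge0_integral_iid_prob0; last exact: m1.
  by rewrite /lin !big_ord0 addr0 mul0e adde0.
rewrite ge0_integral_iid_probS; last 2 first.
- exact: m1.
- by move=> x; rewrite lee_fin sqr_ge0.
under eq_integral => t _.
  under eq_integral do rewrite linS addrA.
  rewrite IH.
  over.
rewrite (@ge0_integralD _ _ _ N setT measurableT); last 4 first.
- by move=> x _; rewrite lee_fin sqr_ge0.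
- apply/measurable_EFinP; apply: measurable_funX.
  by apply: measurable_funD => //; exact: measurable_funM.
- by move=> x _; rewrite mule_ge0// lee_fin sumr_ge0// => i _; exact: sqr_ge0.
- exact: measurable_cst.
rewrite integral_probability_cst stdnormal_affine_sqr -addeA.
move: (\int[N]_x _) v0 => v v0.
rewrite big_ord_recl EFinD ge0_muleDl//= ?lee_fin ?sqr_ge0//.
by apply: sumr_ge0 => i _; exact: sqr_ge0.
Qed.

Lemma std_gaussian_mgf p (d : 'I_p -> R) :
  \int[std_gaussian p]_x (expR (lin d x))%:E =
  (expR ((\sum_j d j ^+ 2) / 2))%:E.
Proof.
have m1 k (e : 'I_k -> R) : measurable_fun setT (fun x => (expR (lin e x))%:E).
  apply/measurable_EFinP; apply: measurableT_comp => //; exact: measurable_lin.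
elim: p d => [|p IH] d.
  rewrite ge0_integral_iid_prob0; last exact: m1.
  by rewrite /lin !big_ord0 mul0r.
rewrite ge0_integral_iid_probS; last 2 first.
- exact: m1.
- by move=> x; rewrite lee_fin expR_ge0.
under eq_integral => t _.
  under eq_integral do rewrite linS expRD EFinM.
  rewrite (@ge0_integralZl _ _ _ (iid_prob N p) setT measurableT); last 3 first.
  - exact: m1.
  - by move=> x _; rewrite lee_fin expR_ge0.
  - by rewrite lee_fin expR_ge0.
  rewrite IH.
  over.
rewrite (@ge0_integralZr _ _ _ N setT measurableT); last 3 first.
- exact: measurable_expR_lin.
- by move=> x _; rewrite lee_fin expR_ge0.
- by rewrite lee_fin expR_ge0.
by rewrite stdnormal_mgf -EFinM -expRD big_ord_recl mulrDl.
Qed.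

(* Linearise the square: expR (h ^ 2) is the moment generating function of an
   independent standard normal variable at sqrt 2 * h. *)
Lemma std_gaussian_sqr_mgf p (d : 'I_p -> R) : (\sum_j d j ^+ 2 < 2^-1)%R ->
  \int[std_gaussian p]_x (expR (lin d x ^+ 2))%:E =
  ((Num.sqrt (1 - 2 * \sum_j d j ^+ 2))^-1)%:E.
Proof.
move=> d1.
pose f (z : p.-tuple R * R) := (expR (Num.sqrt 2 * lin d z.1 * z.2))%:E.
have mf : measurable_fun setT f.
  apply/measurable_EFinP; apply: measurableT_comp => //.
  apply: measurable_funM => //; apply: measurable_funM => //.
  by apply: measurableT_comp => //; exact: measurable_lin.
have f0 z : 0 <= f z by rewrite lee_fin expR_ge0.
have s2 : (Num.sqrt 2 ^+ 2 = 2 :> R)%R by rewrite sqr_sqrtr.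
transitivity (\int[std_gaussian p]_x \int[N]_y f (x, y)).
  apply: eq_integral => x _; rewrite /f /= stdnormal_mgf; congr (expR _)%:E.
  by rewrite exprMn s2 mulrAC divff// mul1r.
(* For fixed y the integral over x is again a moment generating function, equal to exp(y^2 * sum_j
   d_j^2); [stdnormal_sqr_mgf] then handles y. *)
rewrite (fubini_tonelli (m1 := std_gaussian p) (m2 := N) f mf f0).
rewrite -stdnormal_sqr_mgf//; apply: eq_integral => y _.
transitivity (\int[std_gaussian p]_x
    (expR (lin (fun j => Num.sqrt 2 * y * d j)%R x))%:E).
  apply: eq_integral => x _; rewrite /f /=; congr (expR _)%:E.
  rewrite /lin mulrAC mulr_sumr; apply: eq_bigr => j _.
  by rewrite mulrA.
rewrite std_gaussian_mgf; congr (expR _)%:E.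
under eq_bigr do rewrite exprMn.
by rewrite -mulr_sumr exprMn s2 mulrAC [(2 * _)%R]mulrC mulfK// mulrC.
Qed.

End GaussianVector.

Section Regression.
Local Open Scope ereal_scope.
Context {R : realType} {p : nat}.
Implicit Types b : 'cV[R]_p.

Local Notation N := (@stdnormal R).
Local Notation G := (@std_gaussian R p).
Local Notation obs := (R * p.-tuple R)%type.

Lemma measurable_inner b : measurable_fun setT (inner b).
Proof. exact: (measurable_lin (fun j => b j 0%R)). Qed.

Lemma innerD b b' x : inner (b + b') x = (inner b x + inner b' x)%R.
Proof.
rewrite /inner -big_split; apply: eq_bigr => j _.
by rewrite !mxE mulrDl.
Qed.

Definition response b (z : obs) : obs := (z.1 + inner b z.2, z.2)%R.

Lemma measurable_response b : measurable_fun setT (response b).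
Proof.
apply: measurable_fun_pair => //; apply: measurable_funD => //.
by apply: measurableT_comp => //; exact: measurable_inner.
Qed.

HB.instance Definition _ b :=
  isMeasurableFun.Build _ _ _ _ (response b) (measurable_response b).

Definition regression_law b : probability obs R :=
  distribution (N \x G) (response b).

Lemma ge0_integral_regression_law b (f : obs -> \bar R) :
  measurable_fun setT f -> (forall z, 0 <= f z) ->
  \int[regression_law b]_z f z =
  \int[G]_x \int[N]_e f (e + inner b x, x)%R.
Proof.
move=> mf f0; rewrite ge0_integral_distribution//.
rewrite (fubini_tonelli2 (m1 := N) (m2 := G))//.
- by apply: measurableT_comp => //; exact: measurable_response.
- by move=> z; exact: f0.
Qed.

(** With the noise e fixed and the design integrated first, the risk becomes an instance of
    [std_gaussian_affine_sqr] with a = e. *)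
Lemma ge0_integral_regression_law1 b (f : obs -> \bar R) :
  measurable_fun setT f -> (forall z, 0 <= f z) ->
  \int[regression_law b]_z f z =
  \int[N]_e \int[G]_x f (e + inner b x, x)%R.
Proof.
move=> mf f0; rewrite ge0_integral_distribution//.
rewrite (fubini_tonelli1 (m1 := N) (m2 := G))//.
- by apply: measurableT_comp => //; exact: measurable_response.
- by move=> z; exact: f0.
Qed.

Lemma std_gaussian_design_regression_law b :
  std_gaussian_design (regression_law b).
Proof.
move=> U mU.
have -> : regression_law b [set z | forall j, U j (tnth z.2 j)] =
    (N \x G) ([set: R] `*` [set x | forall j, U j (tnth x j)]).
  rewrite /= /distribution/= /pushforward; congr (_ _).
  by apply/seteqP; split=> [z /= H|z /= [_ H]].
rewrite product_measure1E//; last exact: measurable_tuple_box.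
rewrite [X in (X * _)%E](probability_setT N) mul1e.
exact: (@iid_law_iid_prob _ _ R N p U mU).
Qed.

(** The function is a partial integral, over the noise, of a jointly measurable indicator, so
    Tonelli applies. *)
Lemma measurable_normal_prob_inner b (U : set R) : measurable U ->
  measurable_fun setT (fun x : p.-tuple R => normal_prob (inner b x) 1 U).
Proof.
move=> mU.
pose f (z : R * p.-tuple R) := (\1_U (z.1 + inner b z.2)%R : R)%:E.
have mf : measurable_fun setT f.
  apply/measurable_EFinP; apply: measurableT_comp => //.
  apply: measurable_funD => //.
  by apply: measurableT_comp => //; exact: measurable_inner.
have f0 z : 0 <= f z by rewrite lee_fin.
have := measurable_fun_fubini_tonelli_G (m1 := N) f mf f0.
congr (measurable_fun _ _); apply/funext => x.
rewrite /fubini_G /f normal_prob_shift//.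
rewrite -stdnormalE.
have mV : measurable [set x0 | U (x0 + inner b x)%R].
  have : measurable_fun setT (fun y : R => (y + inner b x)%R).
    exact: measurable_funD.
  by move=> /(_ measurableT _ mU); rewrite setTI.
transitivity (\int[N]_e (\1_[set e | U (e + inner b x)%R] e)%:E).
  by apply: eq_integral => e _; rewrite !indicE.
by rewrite integral_indic// setIT.
Qed.

Lemma gaussian_response_regression_law b :
  gaussian_response (regression_law b) b.
Proof.
move=> U V mU mV.
pose g (x : p.-tuple R) := normal_prob (inner b x) 1 U.
have mg : measurable_fun setT g by exact: measurable_normal_prob_inner.
have mS : measurable [set z : obs | V z.2].
  by rewrite -[X in measurable X]setTI; exact: measurable_snd.
rewrite [RHS]integral_mkcond.
transitivity (\int[regression_law b]_z ((\1_V z.2 : R)%:E * g z.2)); last first.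
  apply: eq_integral => z _; rewrite patchE indicE.
  have -> : (z \in [set z : obs | V z.2]) = (z.2 \in V).
    by apply/idP/idP; rewrite !inE.
  by case: (z.2 \in V); rewrite ?mul1e ?mul0e.
have m1V : measurable_fun setT (fun x : p.-tuple R => (\1_V x : R)%:E).
  by apply/measurable_EFinP; exact: measurable_indic.
rewrite ge0_integral_regression_law; last 2 first.
- apply: emeasurable_funM; first exact: (measurableT_comp m1V measurable_snd).
  exact: (measurableT_comp mg measurable_snd).
- by move=> z; rewrite mule_ge0// lee_fin.
transitivity (\int[G]_x ((\1_V x : R)%:E * g x)); last first.
  apply: eq_integral => x _.
  exact/esym/(integral_probability_cst N ((\1_V x : R)%:E * g x)).
have mUV : measurable (U `*` V) by exact: measurableX.
transitivity (\int[regression_law b]_z (\1_(U `*` V) z)%:E).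
  by rewrite integral_indic// setIT.
rewrite ge0_integral_regression_law; last 2 first.
- by apply/measurable_EFinP; exact: measurable_indic.
- by move=> z; rewrite lee_fin.
apply: eq_integral => x _.
have mW : measurable [set e | U (e + inner b x)%R].
  have : measurable_fun setT (fun y : R => (y + inner b x)%R).
    exact: measurable_funD.
  by move=> /(_ measurableT _ mU); rewrite setTI.
transitivity (\int[N]_e
    ((\1_V x : R)%:E * (\1_[set e | U (e + inner b x)%R] e)%:E)).
  apply: eq_integral => e _; rewrite -EFinM !indicE -natrM mulnb.
  congr (_%:R)%:E; congr nat_of_bool; apply/idP/andP; rewrite !inE.
    by move=> [].
  by move=> [].
rewrite ge0_integralZl//.
- by rewrite integral_indic// setIT /g normal_prob_shift.
- by apply/measurable_EFinP; exact: measurable_indic.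
Qed.

(* Only the sign of the second moment of N matters for the minimisers. *)
Lemma risk_regression_law b b' :
  risk sqloss (regression_law b) b' =
  (2^-1)%:E * ((1 + \sum_j (b j 0 - b' j 0) ^+ 2)%:E * \int[N]_x (x ^+ 2)%:E).
Proof.
have mf : measurable_fun setT (fun z : obs => (sqloss z.1 (inner b' z.2))%:E).
  apply/measurable_EFinP; apply: measurable_funM => //; apply: measurable_funX.
  apply: measurable_funB => //; apply: measurableT_comp => //.
  exact: measurable_inner.
rewrite /risk unlock ge0_integral_regression_law1//; last first.
  by move=> z; rewrite lee_fin mulr_ge0 ?invr_ge0// sqr_ge0.
have v0 : 0 <= \int[N]_x (x ^+ 2)%:E.
  by apply: integral_ge0 => x _; rewrite lee_fin sqr_ge0.
set D := (\sum_j _)%R.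
have D0 : (0 <= D)%R by apply: sumr_ge0 => j _; exact: sqr_ge0.
transitivity (\int[N]_e
    ((2^-1)%:E * ((e ^+ 2)%:E + D%:E * \int[N]_x (x ^+ 2)%:E))).
  apply: eq_integral => e _.
  rewrite -(std_gaussian_affine_sqr e (fun j => b j 0 - b' j 0)%R).
  rewrite -ge0_integralZl//.
  - apply: eq_integral => x _; rewrite -EFinM; congr (_ * _ ^+ 2)%:E.
    rewrite /inner /lin -addrA -sumrB; congr (_ + _)%R.
    by apply: eq_bigr => j _; rewrite mulrBl.
  - apply/measurable_EFinP; apply: measurable_funX.
    by apply: measurable_funD => //; exact: measurable_lin.
  - by move=> x _; rewrite lee_fin sqr_ge0.
have msq : measurable_fun setT (fun x : R => (x ^+ 2)%:E).
  by apply/measurable_EFinP; exact: measurable_funX.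
rewrite (@ge0_integralZl _ _ _ N setT measurableT); last 3 first.
- exact: emeasurable_funD.
- by move=> x _; rewrite adde_ge0 ?mule_ge0// lee_fin sqr_ge0.
- by rewrite lee_fin.
congr (_ * _).
rewrite (@ge0_integralD _ _ _ N setT measurableT); last 4 first.
- by move=> x _; rewrite lee_fin sqr_ge0.
- exact: msq.
- by move=> x _; rewrite mule_ge0.
- exact: measurable_cst.
rewrite integral_probability_cst.
move: (\int[N]_x _) v0 => v v0.
by rewrite EFinD ge0_muleDl ?lee_fin// mul1e.
Qed.

(** The density of the law with coefficients b' relative to that with b: the two share the design
    law, so it is the ratio of the conditional normal densities of the response. *)
Definition gaussian_lr b b' (z : obs) : R :=
  expR (inner (b' - b) z.2 * (z.1 - inner b z.2) - inner (b' - b) z.2 ^+ 2 / 2).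

Lemma measurable_gaussian_lr b b' : measurable_fun setT (gaussian_lr b b').
Proof.
have mi c : measurable_fun setT (fun z : obs => inner c z.2).
  by apply: measurableT_comp => //; exact: measurable_inner.
apply: measurableT_comp => //; apply: measurable_funB.
  by apply: measurable_funM => //; exact: measurable_funB.
by apply: measurable_funM => //; exact: measurable_funX.
Qed.

Lemma ge0_integral_gaussian_lr b b' (f : obs -> \bar R) :
  measurable_fun setT f -> (forall z, 0 <= f z) ->
  \int[regression_law b']_z f z =
  \int[regression_law b]_z (f z * (gaussian_lr b b' z)%:E).
Proof.
move=> mf f0.
rewrite !ge0_integral_regression_law//; last 2 first.
- apply: emeasurable_funM => //; apply/measurable_EFinP.
  exact: measurable_gaussian_lr.
- by move=> z; rewrite mule_ge0// lee_fin expR_ge0.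
apply: eq_integral => x _.
pose h := inner (b' - b) x.
transitivity (\int[N]_e (fun e => f (e + inner b x, x)%R) (e + h)%R).
  apply: eq_integral => e _ /=; congr (f (_, _)).
  by rewrite -addrA; congr (_ + _)%R; rewrite /h -innerD subrK.
have mF : measurable_fun setT (fun e : R => f (e + inner b x, x)%R).
  apply: measurableT_comp => //; apply: measurable_fun_pair => //.
  exact: measurable_funD.
etransitivity.
  by apply: (@ge0_integral_stdnormal_translate _
    (fun e : R => f (e + inner b x, x)%R) h).
by apply: eq_integral => e _; rewrite /gaussian_lr /= addrK.
Qed.

(** Given x, with h = <b' - b, x>, the squared ratio has noise mean exp(h^2). Averaging this over
    the Gaussian variable h needs the variance of h to be below 1/2. *)
Lemma integral_gaussian_lr_sqr b b' :
  (\sum_j (b' j 0 - b j 0) ^+ 2 < 2^-1)%R ->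
  \int[regression_law b]_z ((gaussian_lr b b' z) ^+ 2)%:E =
  ((Num.sqrt (1 - 2 * \sum_j (b' j 0 - b j 0) ^+ 2))^-1)%:E.
Proof.
move=> D2.
rewrite ge0_integral_regression_law; last 2 first.
- apply/measurable_EFinP; apply: measurable_funX.
  exact: measurable_gaussian_lr.
- by move=> z; rewrite lee_fin sqr_ge0.
rewrite -(std_gaussian_sqr_mgf (d := fun j => b' j 0 - b j 0)%R)//.
apply: eq_integral => x _.
have <- : inner (b' - b) x = lin (fun j => b' j 0 - b j 0)%R x.
  by apply: eq_bigr => j _; rewrite !mxE.
set h := inner (b' - b) x.
transitivity (\int[N]_e ((expR (- h ^+ 2))%:E * (expR (2 * h * e))%:E)).
  apply: eq_integral => e _; rewrite /gaussian_lr /= addrK -/h -EFinM -expRD.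
  rewrite expr2 -expRD; congr (expR _)%:E.
  by field.
rewrite (@ge0_integralZl _ _ _ N setT measurableT); last 3 first.
- exact: measurable_expR_lin.
- by move=> e _; rewrite lee_fin expR_ge0.
- by rewrite lee_fin expR_ge0.
rewrite stdnormal_mgf -EFinM -expRD; congr (expR _)%:E.
by field.
Qed.

End Regression.

(** * Parameters for which a given weight vector is optimal *)

(** Cauchy-Schwarz against the constant 1; twice the gap is the sum of all squared differences x_i -
    x_j. *)
Lemma sqr_sum_le (R : realType) (I : finType) (S : {set I}) (x : I -> R) :
  (\sum_(i in S) x i) ^+ 2 <= #|S|%:R * \sum_(i in S) x i ^+ 2.
Proof.
have : 0 <= \sum_(i in S) \sum_(j in S) (x i - x j) ^+ 2.
  by apply: sumr_ge0 => i _; apply: sumr_ge0 => j _; exact: sqr_ge0.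
have -> : \sum_(i in S) \sum_(j in S) (x i - x j) ^+ 2 =
    2 * (#|S|%:R * \sum_(i in S) x i ^+ 2 - (\sum_(i in S) x i) ^+ 2).
  transitivity (\sum_(i in S) (#|S|%:R * x i ^+ 2 + \sum_(j in S) x j ^+ 2 -
                               2 * x i * \sum_(j in S) x j)).
    apply: eq_bigr => i _.
    rewrite (eq_bigr (fun j => x i ^+ 2 + x j ^+ 2 - 2 * x i * x j)); last first.
      by move=> j _; ring.
    by rewrite sumrB big_split /= sumr_const -[_ *+ #|_|]mulr_natl mulr_sumr.
  rewrite sumrB big_split /= sumr_const -mulr_sumr -mulr_suml -mulr_sumr.
  by rewrite -[_ *+ #|_|]mulr_natl; ring.
lra.
Qed.

Section DiagonalModel.
Context {R : realType} {p K : nat}.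
Variables (e : 'I_K -> 'I_p) (e_inj : injective e) (phi : R).
Hypothesis phi0 : 0 < phi.
Implicit Types (w v : 'cV[R]_K) (b : 'cV[R]_p).

Implicit Types c : 'I_K -> R.

Definition diag_design c : 'M[R]_(p, K) :=
  \matrix_(j, k) (c k *+ (j == e k)).

(** The sum of all columns, so that weights v leave the residual c_k (1 - v_k) in direction k. *)
Definition truth c : 'cV[R]_p := diag_design c *m const_mx 1.

Lemma diag_design_mulE c v k : (diag_design c *m v) (e k) 0 = c k * v k 0.
Proof.
rewrite mxE (bigD1 k) //= mxE eqxx mulr1n big1 ?addr0// => l lk.
by rewrite mxE (inj_eq e_inj) eq_sym (negbTE lk) mul0r.
Qed.

Lemma diag_design_sqr c v :
  \sum_j (diag_design c *m v) j 0 ^+ 2 = \sum_k (c k * v k 0) ^+ 2.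
Proof.
transitivity (\sum_j \sum_k
    (diag_design c j k * v k 0 * (diag_design c *m v) j 0)).
  by apply: eq_bigr => j _; rewrite expr2 {1}mxE mulr_suml.
rewrite exchange_big /=; apply: eq_bigr => k _.
rewrite (bigD1 (e k)) //= big1 ?addr0; last first.
  by move=> j jk; rewrite mxE (negbTE jk) !mul0r.
by rewrite diag_design_mulE mxE eqxx mulr1n.
Qed.

Lemma truthE c k : truth c (e k) 0 = c k.
Proof. by rewrite diag_design_mulE mxE mulr1. Qed.

Lemma truth_sub c v :
  truth c - diag_design c *m v = diag_design c *m (const_mx 1 - v).
Proof. by rewrite mulmxBr. Qed.

Lemma truth_dist c c' :
  \sum_j (truth c j 0 - truth c' j 0) ^+ 2 = \sum_k (c k - c' k) ^+ 2.
Proof.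
transitivity (\sum_j truth (fun k => c k - c' k) j 0 ^+ 2).
  apply: eq_bigr => j _; congr (_ ^+ 2).
  rewrite !mxE -sumrB; apply: eq_bigr => k _.
  by rewrite !mxE mulrnBl mulrBl.
by rewrite diag_design_sqr; apply: eq_bigr => k _; rewrite mxE mulr1.
Qed.

(* With this choice all partial derivatives of the quadratic risk at w are
   equal, so that w is the minimiser over the simplex. *)
Definition coef w k := phi / Num.sqrt (1 - w k 0).

Lemma risk_regression_law_le b b1 b2 :
  \sum_j (b j 0 - b1 j 0) ^+ 2 <= \sum_j (b j 0 - b2 j 0) ^+ 2 ->
  (risk sqloss (regression_law b) b1 <= risk sqloss (regression_law b) b2)%E.
Proof.
move=> h; rewrite !risk_regression_law.
apply: lee_wpmul2l => //; apply: lee_wpmul2r; last by rewrite lee_fin lerD2l.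
by apply: integral_ge0 => x _; rewrite lee_fin sqr_ge0.
Qed.

Variable w : 'cV[R]_K.
Hypothesis w_weights : weights w.
Hypothesis w_lt1 : forall k, w k 0 < 1.

Lemma coef_sqr k : coef w k ^+ 2 = phi ^+ 2 / (1 - w k 0).
Proof. by rewrite exprMn exprVn sqr_sqrtr// subr_ge0 ltW. Qed.

Lemma coef_sqr_ge k : phi ^+ 2 <= coef w k ^+ 2.
Proof.
have := w_lt1 k; have [+ _] := w_weights => /(_ k)/andP[w0 _] w1.
rewrite coef_sqr ler_pdivlMr ?subr_gt0//.
by have := sqr_ge0 phi; nra.
Qed.

(** The excess risk is a sum over coordinates: column k matches the truth at [e k], and every
    competitor vanishes elsewhere too. *)
Lemma is_beta_star_diag :
  is_beta_star sqloss (regression_law (truth (coef w)))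
    (fun k => [set e k]%SET) (diag_design (coef w)).
Proof.
move=> k; split=> /= [j|b bk].
  by rewrite inE !mxE => /negbTE ->.
apply: risk_regression_law_le; apply: ler_sum => j _.
have [->|jk] := eqVneq j (e k).
  by rewrite truthE !mxE eqxx mulr1n subrr expr0n sqr_ge0.
by rewrite [col k _ _ _]mxE [diag_design _ _ _]mxE (negbTE jk) mulr0n bk// inE.
Qed.

Lemma is_w_star_diag :
  is_w_star sqloss (regression_law (truth (coef w))) (diag_design (coef w)) w.
Proof.
split=> // v [v01 v1].
apply: risk_regression_law_le.
have E (u : 'cV[R]_K) :
    \sum_j (truth (coef w) j 0 - (diag_design (coef w) *m u) j 0) ^+ 2 =
    \sum_k coef w k ^+ 2 * (1 - u k 0) ^+ 2.
  transitivity (\sum_j (diag_design (coef w) *m (const_mx 1 - u)) j 0 ^+ 2).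
    by apply: eq_bigr => j _; rewrite -truth_sub !mxE.
  by rewrite diag_design_sqr; apply: eq_bigr => k _; rewrite exprMn !mxE.
rewrite !E.
have [_ w1] := w_weights.
(* Tangent line of (1 - v_k)^2 at w_k. Since [coef w k ^+ 2 * (1 - w k 0)] is phi^2 for all k, the
   linear terms add up to a multiple of sum v - sum w = 0. *)
apply: (@le_trans _ _ (\sum_k (coef w k ^+ 2 * (1 - v k 0) ^+ 2 +
                               2 * phi ^+ 2 * (v k 0 - w k 0)))).
  apply: ler_sum => k _.
  have -> : 2 * phi ^+ 2 * (v k 0 - w k 0) =
      coef w k ^+ 2 * (2 * (1 - w k 0) * (v k 0 - w k 0)).
    rewrite coef_sqr; field; rewrite subr_eq0 gt_eqF//.
  rewrite -mulrDr ler_wpM2l ?sqr_ge0//.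
  by have := sqr_ge0 (v k 0 - w k 0); nra.
by rewrite big_split /= -mulr_sumr sumrB v1 w1 subrr mulr0 addr0.
Qed.

Lemma norm2_col_diag k : norm2 (col k (diag_design (coef w))) = `|coef w k|.
Proof.
rewrite /norm2 (bigD1 (e k)) //= big1 ?addr0; last first.
  by move=> j jk; rewrite !mxE (negbTE jk) expr0n.
by rewrite !mxE eqxx mulr1n sqrtr_sqr.
Qed.

(** Dropping the coordinates outside S and using [coef_sqr_ge] leaves Cauchy-Schwarz on S. *)
Lemma phi2_diag : ((phi ^+ 2)%:E <= phi2 (supp w) (diag_design (coef w)) w)%E.
Proof.
apply: le_ereal_inf_tmp => _ [D [_ D0] <-]; rewrite lee_fin.
set S := supp w in D0 *.
have N0 : 0 < norm1_on S D.
  by rewrite lt_neqAle eq_sym D0; apply: sumr_ge0.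
rewrite ler_pdivlMr ?exprn_gt0//.
have -> : norm2 (diag_design (coef w) *m D) ^+ 2 =
    \sum_k (coef w k * D k 0) ^+ 2.
  rewrite /norm2 diag_design_sqr sqr_sqrtr// sumr_ge0// => k _.
  exact: sqr_ge0.
apply: (@le_trans _ _ (phi ^+ 2 * (#|S|%:R * \sum_(k in S) `|D k 0| ^+ 2))).
  by rewrite ler_wpM2l ?sqr_ge0//; exact: sqr_sum_le.
rewrite mulrCA ler_wpM2l// mulr_sumr.
apply: (@le_trans _ _ (\sum_(k in S) (coef w k * D k 0) ^+ 2)).
  apply: ler_sum => k _; rewrite exprMn real_normK ?num_real//.
  by rewrite ler_wpM2r ?sqr_ge0// coef_sqr_ge.
rewrite [leRHS](bigID (mem S)) /= lerDl.
by apply: sumr_ge0 => k _; exact: sqr_ge0.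
Qed.

Lemma model_class_diag (C' : R) (s : nat) : (norm0 w <= s)%N -> 0 <= C' ->
  (forall k, coef w k ^+ 2 <= C' ^+ 2) ->
  model_class sqloss (fun k => [set e k]%SET) C' s phi
    (regression_law (truth (coef w))) w.
Proof.
move=> ws C0 wC; split.
- exact: std_gaussian_design_regression_law.
- by exists (truth (coef w)); exact: gaussian_response_regression_law.
exists (diag_design (coef w)); split.
- exact: is_beta_star_diag.
- exact: is_w_star_diag.
split=> //; last exact: phi2_diag.
by move=> k; rewrite norm2_col_diag -ler_sqr ?nnegrE// real_normK ?num_real.
Qed.

End DiagonalModel.

(** * Packing and averaging *)

Section Codes.
Context {R : realType} (r m : nat).
Implicit Types f g : {ffun 'I_r -> 'I_m}.

(** Hamming distance; a codeword selects one of m positions in each of r blocks. *)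
Definition dist f g : nat := \sum_i (f i != g i).

(** The sum factorises over blocks: each has one agreeing position and m - 1 disagreeing ones. *)
Lemma sum_expr_dist g (x : R) :
  \sum_(f : {ffun 'I_r -> 'I_m}) x ^+ dist f g = (1 + (m%:R - 1) * x) ^+ r.
Proof.
transitivity (\sum_(f : {ffun 'I_r -> 'I_m}) \prod_i (x ^+ (f i != g i))).
  by apply: eq_bigr => f _; rewrite -prodrXr.
rewrite -(bigA_distr_bigA (fun i j => x ^+ (j != g i))) /=.
rewrite (eq_bigr (fun=> 1 + (m%:R - 1) * x)); last first.
  move=> i _; rewrite (bigD1 (g i)) //= eqxx expr0; congr (_ + _).
  rewrite (eq_bigr (fun=> x)); last by move=> j ->; rewrite expr1.
  rewrite sumr_const cardC1 card_ord -subn1 mulrnBr.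
    by rewrite mulrBl mul1r mulr_natl.
  exact: leq_ltn_trans (ltn_ord (g i)).
by rewrite prodr_const card_ord.
Qed.

(* Chernoff bound with weight m^-3 per disagreement. *)
Lemma card_ball_le g : (4 <= m)%N ->
  #|[set f : {ffun 'I_r -> 'I_m} | (24 * dist f g <= r)%N]%SET|%:R <=
  expR (r%:R * ln m%:R / 4) :> R.
Proof.
move=> m4.
have m4R : 4 <= m%:R :> R by rewrite (ler_nat _ 4).
have m0 : 0 < m%:R :> R by lra.
set L := ln m%:R.
have mL : m%:R = expR L by rewrite lnK ?posrE.
(* From 1 - L <= exp(-L) = 1/m <= 1/4. *)
have L34 : 3 / 4 <= L.
  have := expR_ge1Dx (- L); rewrite expRN -mL => h.
  have : m%:R^-1 <= 4^-1 :> R by rewrite lef_pV2 ?posrE.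
  lra.
pose x : R := expR (- (3 * L)).
have xE : x = m%:R^-1 ^+ 3 by rewrite /x expRN -[3]/(3%:R) expRM_natl -mL exprVn.
(* Here (m - 1) / m^3 <= 1/m^2 <= 1/16, which is below 3/32 <= L / 8. *)
have base : 1 + (m%:R - 1) * x <= expR (L / 8).
  have : (m%:R - 1) * x <= 16^-1.
    rewrite xE exprVn ler_pdivrMr ?exprn_gt0//.
    by rewrite !exprS expr0 mulr1; nra.
  by have := expR_ge1Dx (L / 8); lra.
have B : \sum_(f : {ffun 'I_r -> 'I_m}) x ^+ dist f g <= expR (r%:R * L / 8).
  rewrite sum_expr_dist -mulrA expRM_natl lerXn2r// nnegrE ?expR_ge0//.
  by rewrite addr_ge0// mulr_ge0 ?expR_ge0//; lra.
pose ball := [set f : {ffun 'I_r -> 'I_m} | (24 * dist f g <= r)%N]%SET.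
(* Each member of the ball has weight at least exp(-3L * r/24). With [B] this gives exp(rL/8 +
   rL/8). *)
have A : expR (- (r%:R * L / 8)) * #|ball|%:R <=
    \sum_(f : {ffun 'I_r -> 'I_m}) x ^+ dist f g.
  rewrite mulr_natr -sumr_const [leRHS](bigID (mem ball)) /=.
  rewrite -[leLHS]addr0; apply: lerD; last first.
    by apply: sumr_ge0 => f _; rewrite exprn_ge0// expR_ge0.
  apply: ler_sum => f; rewrite inE => fr.
  rewrite /x -expRM_natl ler_expR.
  have : 24 * (dist f g)%:R <= r%:R :> R by rewrite -natrM ler_nat.
  by nra.
have := le_trans A B; rewrite expRN mulrC ler_pdivrMr ?expR_gt0// -expRD.
move/le_trans; apply.
by rewrite ler_expR; lra.
Qed.

End Codes.

Section Averaging.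
Context d (T : measurableType d) (R : realType) (I : finType).
Variables (P0 : probability T R) (P : I -> probability T R) (A : I -> set T).

(** [B] bounds how many of the events can hold at one point, hence the sum of their probabilities
    under [P0]; some index does no worse than the average. *)
Lemma exists_unlikely (c k B : R) : (0 < #|I|)%N -> 0 <= c ->
  (forall i, measurable (A i)) ->
  (forall i S, measurable S -> fine (P i S) <= c * fine (P0 S) + k) ->
  (forall z, (\sum_i \1_(A i) z) <= B) ->
  exists i, fine (P i (A i)) <= c * (B / #|I|%:R) + k.
Proof.
move=> I0 c0 mA Pk zB.
have mI i : measurable_fun setT (fun z => (\1_(A i) z : R)%:E).
  by apply/measurable_EFinP; exact: measurable_indic.
have P0B : \sum_i fine (P0 (A i)) <= B.
  rewrite -lee_fin -sumEFin.
  rewrite (eq_bigr (fun i => \int[P0]_z (\1_(A i) z)%:E)%E); last first.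
    by move=> i _; rewrite integral_indic// setIT fineK ?fin_num_measure.
  rewrite -ge0_integral_sum//.
  - apply: (@le_trans _ _ (\int[P0]_z B%:E)%E); last first.
      by rewrite integral_probability_cst.
    apply: ge0_le_integral => //.
    + by move=> z _; apply: sume_ge0 => i _; rewrite lee_fin.
    + by apply: emeasurable_sum => i; exact: mI.
    + by move=> z _; rewrite sumEFin lee_fin.
apply: contrapT => /forallNP H.
have : \sum_i fine (P i (A i)) <= c * B + #|I|%:R * k.
  apply: (@le_trans _ _ (\sum_i (c * fine (P0 (A i)) + k))).
    by apply: ler_sum => i _; exact: Pk.
  rewrite big_split /= -mulr_sumr sumr_const -[_ *+ #|_|]mulr_natl lerD2r.
  by rewrite ler_wpM2l.
apply/negP; rewrite -ltNge.
have -> : c * B + #|I|%:R * k = \sum_(i : I) (c * (B / #|I|%:R) + k).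
  rewrite sumr_const -[_ *+ #|_|]mulr_natl; field.
  by rewrite pnatr_eq0 -lt0n.
have [i0 _] : exists i0 : I, true by move/card_gt0P: I0 => [i _]; exists i.
apply: ltr_sum; first by apply/hasP; exists i0; rewrite ?mem_index_enum.
by move=> i _; rewrite ltNge; apply/negP; exact: H.
Qed.

End Averaging.

(** * Spiked weight vectors: support, separation and distance of coefficients *)

Section SpikedWeights.
Context {R : realType} {K r m : nat}.
Variables (z0 : 'I_K) (idx : 'I_r -> 'I_m -> 'I_K).
Hypothesis idx_inj : forall i j i' j', idx i j = idx i' j' -> i = i' /\ j = j'.
Hypothesis idx_z0 : forall i j, idx i j != z0.
Variable eta : R.
Hypotheses (eta0 : 0 < eta) (eta4 : eta <= 1 / 4) (r0 : (0 < r)%N).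
Implicit Types f g : {ffun 'I_r -> 'I_m}.

(** The common part of all spiked weights, of total mass 1 - eta; it supplies the coefficients of
    the reference law. *)
Definition spike : 'cV[R]_K := \col_k ((1 - eta) *+ (k == z0)).

Definition spiked_weights f : 'cV[R]_K :=
  \col_k ((1 - eta) *+ (k == z0) + \sum_i (eta / r%:R) *+ (k == idx i (f i))).

Let rR : 0 < r%:R :> R. Proof. by rewrite ltr0n. Qed.

Let etar : 0 < eta / r%:R. Proof. by rewrite divr_gt0. Qed.

Let etar_le : eta / r%:R <= eta.
Proof. by rewrite ler_pdivrMr// ler_peMr ?(ltW eta0)// ler1n. Qed.

Lemma spiked_weights_z0 f : spiked_weights f z0 0 = 1 - eta.
Proof.
rewrite mxE eqxx mulr1n big1 ?addr0// => i _.
by rewrite eq_sym (negbTE (idx_z0 _ _)).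
Qed.

Lemma spiked_weights_idx f i j :
  spiked_weights f (idx i j) 0 = (eta / r%:R) *+ (f i == j).
Proof.
rewrite mxE (negbTE (idx_z0 _ _)) add0r (bigD1 i) //= big1 ?addr0.
  congr (_ *+ nat_of_bool _); apply/eqP/eqP => [/idx_inj[_ ->]//|<-//].
move=> k ki; case: eqP => // /idx_inj[ik _].
by rewrite ik eqxx in ki.
Qed.

Lemma spiked_weights_ge0 f k : 0 <= spiked_weights f k 0.
Proof.
move: eta0 eta4 => eta_gt0 eta_le4.
have eta1 : 0 <= 1 - eta by lra.
rewrite mxE addr_ge0//; first exact: mulrn_wge0.
by apply: sumr_ge0 => i _; rewrite mulrn_wge0// ltW.
Qed.

Lemma spiked_weights_le f k : k != z0 -> spiked_weights f k 0 <= eta / r%:R.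
Proof.
move=> kz; have [/existsP[i /eqP ->]|/existsPn ki] :=
  boolP [exists i, k == idx i (f i)].
  by rewrite spiked_weights_idx eqxx.
rewrite mxE (negbTE kz) add0r big1 ?ltW// => i _.
by rewrite (negbTE (ki i)).
Qed.

Lemma spiked_weights_le_spike f k : spiked_weights f k 0 <= 1 - eta.
Proof.
move: eta0 eta4 => eta_gt0 eta_le4.
have [->|kz] := eqVneq k z0; first by rewrite spiked_weights_z0.
by rewrite (le_trans (spiked_weights_le f kz))// (le_trans etar_le)//; lra.
Qed.

Lemma sum_spiked_weights f : \sum_k spiked_weights f k 0 = 1.
Proof.
under eq_bigr do rewrite mxE.
rewrite big_split /= -[LHS]/(_ + _) exchange_big /=.
rewrite (bigD1 z0) //= eqxx big1 ?addr0; last by move=> k /negbTE ->.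
rewrite (eq_bigr (fun=> eta / r%:R)); last first.
  move=> i _; rewrite (bigD1 (idx i (f i))) //= eqxx big1 ?addr0//.
  by move=> k /negbTE ->.
rewrite sumr_const card_ord -[_ *+ r]mulr_natl mulrCA divff ?gt_eqF//.
by rewrite mulr1n; ring.
Qed.

Lemma weights_spiked_weights f : weights (spiked_weights f).
Proof.
move: eta0 eta4 => eta_gt0 eta_le4.
split; last exact: sum_spiked_weights.
move=> k; rewrite spiked_weights_ge0 /=.
by rewrite (le_trans (spiked_weights_le_spike f k))//; lra.
Qed.

Lemma norm0_spiked_weights f : (norm0 (spiked_weights f) <= r.+1)%N.
Proof.
apply: (@leq_trans #|(z0 |: [set idx i (f i) | i : 'I_r])%SET|).
  apply: subset_leq_card; apply/fintype.subsetP => k.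
  rewrite !inE => wk; have [//|kz] := eqVneq k z0.
  apply: contraNT wk => ki; rewrite mxE (negbTE kz) add0r big1// => i _.
  by case: eqP => // kE; case/negP: ki; apply/imsetP; exists i.
rewrite cardsU1 -add1n leq_add ?leq_b1//.
by rewrite (leq_trans (leq_imset_card _ _))// card_ord.
Qed.

(** In each block where f and g differ, the position selected by f carries mass eta / r under f and
    none under g. *)
Lemma norm1_spiked_weights f g :
  eta / r%:R * (dist f g)%:R <= norm1 (spiked_weights f - spiked_weights g).
Proof.
have subE k : (spiked_weights f - spiked_weights g) k 0 =
    spiked_weights f k 0 - spiked_weights g k 0 by rewrite !mxE.
pose h (i : 'I_r) := idx i (f i).
have h_inj : injective h by move=> i i' /idx_inj[].
apply: (@le_trans _ _
    (\sum_i `|(spiked_weights f - spiked_weights g) (h i) 0|)).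
  rewrite /dist natr_sum mulr_sumr; apply: ler_sum => i _.
  rewrite subE !spiked_weights_idx eqxx mulr1n eq_sym.
  by case: eqVneq => _; rewrite ?mulr0 ?mulr1// mulr0n subr0 ger0_norm// ltW.
rewrite /norm1 [leRHS](bigID (mem [set h i | i : 'I_r]%SET)) /=.
rewrite big_imset /=; last first.
  by move=> i i' _ _; exact: h_inj.
rewrite lerDl; exact: sumr_ge0.
Qed.

(** The coefficients agree at [z0]. Elsewhere a weight u contributes at most phi^2 u^2 <= phi^2 (eta
    / r) u, and these weights sum to eta. *)
Lemma coef_spiked_weights_dist (phi : R) f :
  \sum_k (coef phi (spiked_weights f) k - coef phi spike k) ^+ 2 <=
  phi ^+ 2 * eta ^+ 2 / r%:R.
Proof.
move: eta0 eta4 => eta_gt0 eta_le4.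
apply: (@le_trans _ _
    (\sum_(k | k != z0) phi ^+ 2 * (eta / r%:R) * spiked_weights f k 0)).
  rewrite (bigD1 z0) //= /coef spiked_weights_z0 [spike _ _]mxE eqxx mulr1n.
  rewrite subrr expr0n add0r.
  apply: ler_sum => k kz.
  rewrite [spike _ _]mxE (negbTE kz) subr0 sqrtr1 divr1.
  have := spiked_weights_ge0 f k; have := spiked_weights_le f kz.
  move: (spiked_weights f k 0) => u ule u0.
  have -> : phi / Num.sqrt (1 - u) - phi =
      phi * ((Num.sqrt (1 - u))^-1 - 1) by ring.
  rewrite exprMn -mulrA ler_wpM2l ?sqr_ge0//.
  (* The bound (1 - u)^(-1/2) - 1 <= u amounts to (1 + u)^2 (1 - u) >= 1, which holds for 0 <= u <=
     1/4. *)
  apply: (@le_trans _ _ (u ^+ 2)); last by rewrite expr2 ler_wpM2r.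
  have u4 : u <= 1 / 4 by rewrite (le_trans ule)// (le_trans etar_le).
  set q := Num.sqrt (1 - u).
  have q0 : 0 < q by rewrite sqrtr_gt0; lra.
  have q2 : q ^+ 2 = 1 - u by rewrite sqr_sqrtr//; lra.
  have q1 : q <= 1.
    by rewrite -(@ler_pXn2r _ 2) ?nnegrE ?(ltW q0)// q2 expr1n; lra.
  rewrite ler_sqr ?nnegrE//; last first.
    by rewrite subr_ge0 -[leLHS]invr1 lef_pV2 ?posrE.
  rewrite lerBlDr -[leLHS]mul1r ler_pdivrMr//.
  rewrite -(@ler_pXn2r _ 2) ?nnegrE ?mulr_ge0 ?addr_ge0 ?(ltW q0)//.
  by rewrite exprMn q2 expr1n; nra.
rewrite -mulr_sumr; have := sum_spiked_weights f.
rewrite (bigD1 z0) //= spiked_weights_z0 => S.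
have -> : \sum_(k | k != z0) spiked_weights f k 0 = eta by lra.
by rewrite expr2 !mulrA [_ / _ * _]mulrAC.
Qed.

End SpikedWeights.

(** * The lower bound *)

(** After squaring, 1 / (1 - 2x) <= 1 + 4x <= exp(4x), the first step by x <= 1/4. *)
Lemma invr_sqrt_le_expR (R : realType) (x : R) : 0 <= x -> x <= 1 / 4 ->
  (Num.sqrt (1 - 2 * x))^-1 <= expR (2 * x).
Proof.
move=> x0 x4; have y0 : 0 < 1 - 2 * x by lra.
have q0 : 0 < Num.sqrt (1 - 2 * x) by rewrite sqrtr_gt0.
rewrite -[leRHS]invrK -expRN lef_pV2 ?posrE ?expR_gt0//.
rewrite -(@ler_pXn2r _ 2) ?nnegrE ?expR_ge0 ?(ltW q0)//.
rewrite sqr_sqrtr ?(ltW y0)// expr2 -expRD.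
have -> : - (2 * x) + - (2 * x) = - (4 * x) by ring.
rewrite expRN -[leRHS]invrK lef_pV2 ?posrE ?expR_gt0 ?invr_gt0//.
apply: le_trans (expR_ge1Dx _).
rewrite -[leLHS]mul1r ler_pdivrMr//; nra.
Qed.

(** There will be V^4 codewords, at most V of them close to one estimate. Taking c = 9/20 V^3 turns
    the averaged term into 9/20 and leaves 1/20 for the chi-square term, of order V^2 / V^3. *)
Lemma testing_error_le (R : realType) (V a : R) : 0 < V -> 2 <= V ^+ 2 ->
  a <= V ^+ 2 / 100 ->
  1 < 9 / 20 * V ^+ 3 /\
  9 / 20 * V ^+ 3 * (V / V ^+ 4) + a / (4 * (9 / 20 * V ^+ 3 - 1)) <= 1 / 2.
Proof.
move=> V0 V2 aV.
have V14 : 7 / 5 <= V by nra.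
have V3 : V ^+ 2 * (7 / 5) <= V ^+ 3.
  by rewrite [leRHS]exprSr ler_wpM2l// sqr_ge0.
split; first by lra.
have -> : 9 / 20 * V ^+ 3 * (V / V ^+ 4) = 9 / 20 by field; rewrite gt_eqF.
rewrite -lerBrDl ler_pdivrMr; lra.
Qed.

(** With l = r ln m, the power is at most exp(2ny) <= exp(l/400). Then exp(t) - 1 <= t exp(t) at t =
    l/400, and both l/4 and exp(l/400) are at most exp(l/4). *)
Lemma chi2_le (R : realType) (n r m : nat) (x y : R) : (4 <= m)%N ->
  0 <= x -> x <= y -> y <= 1 / 16 -> n%:R * y <= r%:R * ln m%:R / 800 ->
  (Num.sqrt (1 - 2 * x))^-1 ^+ n - 1 <= expR (r%:R * ln m%:R / 4) ^+ 2 / 100.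
Proof.
move=> m4 x0 xy y16.
have L0 : 0 <= ln m%:R :> R.
  by rewrite ln_ge0// (le_trans _ (_ : 4%:R <= m%:R))// ?ler1n// ler_nat.
have rR : 0 <= r%:R :> R by [].
have : 0 <= r%:R * ln m%:R :> R by exact: mulr_ge0.
move: (r%:R * ln m%:R) => l l0 nyl.
have q : (Num.sqrt (1 - 2 * x))^-1 <= expR (2 * x).
  by apply: invr_sqrt_le_expR => //; lra.
have an : (Num.sqrt (1 - 2 * x))^-1 ^+ n <= expR (l / 400).
  apply: (@le_trans _ _ (expR (2 * x) ^+ n)).
    by rewrite lerXn2r// nnegrE ?expR_ge0// invr_ge0 sqrtr_ge0.
  rewrite -expRM_natl ler_expR.
  apply: (@le_trans _ _ (2 * (n%:R * y))); last by lra.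
  by rewrite mulrCA ler_wpM2l// ler_wpM2l.
rewrite lerBlDr (le_trans an)// -lerBlDr.
have lV : l / 4 <= expR (l / 4) by have := expR_ge1Dx (l / 4); lra.
have eV : expR (l / 400) <= expR (l / 4) by rewrite ler_expR; lra.
have V0 : 0 < expR (l / 4) by exact: expR_gt0.
have E0 : 0 < expR (l / 400) by exact: expR_gt0.
have : expR (l / 400) - 1 <= l / 400 * expR (l / 400).
  have := expR_ge1Dx (- (l / 400)); rewrite expRN => h.
  have : (1 + - (l / 400)) * expR (l / 400) <= 1.
    by rewrite -ler_pdivlMr// div1r.
  lra.
move=> /le_trans; apply.
have -> : l / 400 * expR (l / 400) = (l / 4) * expR (l / 400) / 100 by field.
by rewrite ler_wpM2r ?invr_ge0// expr2 ler_pM ?(ltW E0) ?divr_ge0.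
Qed.

Lemma measurable_norm1_sub (R : realType) d (T : measurableType d) K
    (f : T -> 'cV[R]_K) (w : 'cV[R]_K) :
  (forall k, measurable_fun setT (fun z => f z k 0)) ->
  measurable_fun setT (fun z => norm1 (f z - w)).
Proof.
move=> mf; apply: (@measurable_sum _ _ _ _ _ _
  (fun k z => `|(f z - w) k 0|)) => k.
apply: measurableT_comp => //.
rewrite [X in measurable_fun _ X](_ : _ = fun z => f z k 0 - w k 0).
  exact: measurable_funB.
by apply/funext => z; rewrite !mxE.
Qed.

Lemma norm1_triangle (R : realType) K (u v w : 'cV[R]_K) :
  norm1 (v - w) <= norm1 (u - v) + norm1 (u - w).
Proof.
rewrite /norm1 -big_split; apply: ler_sum => k _ /=; rewrite !mxE.
have -> : v k 0 - w k 0 = (u k 0 - w k 0) - (u k 0 - v k 0) by ring.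
by rewrite (le_trans (ler_normB _ _))// addrC.
Qed.

Section LowerBound.
Context {R : realType} {p K r m : nat}.
Variables (e : 'I_K -> 'I_p) (z0 : 'I_K) (idx : 'I_r -> 'I_m -> 'I_K).
Variables (n s : nat) (C' phi eta : R).

(** [phi ^+ 2 / eta] is the square of the largest coefficient, at [z0]. The bound 1/16 makes the
    chi-square divergence finite and the last hypothesis makes it small. The threshold eta / 48 is
    half the separation of codewords differing in r / 24 blocks. *)
Lemma minimax_prob_ge_half :
  injective e ->
  (forall i j i' j', idx i j = idx i' j' -> i = i' /\ j = j') ->
  (forall i j, idx i j != z0) ->
  (0 < r)%N -> (4 <= m)%N -> (r < s)%N ->
  0 < C' -> 0 < phi -> 0 < eta -> eta <= 1 / 4 ->
  phi ^+ 2 / eta <= C' ^+ 2 ->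
  phi ^+ 2 * eta ^+ 2 / r%:R <= 1 / 16 ->
  n%:R * (phi ^+ 2 * eta ^+ 2 / r%:R) <= r%:R * ln m%:R / 800 ->
  ((1 / 2)%:E <=
     minimax_prob n sqloss (fun k => [set e k]%SET) C' s phi (eta / 48))%E.
Proof.
move=> e_inj idx_inj idx_z0 r0 m4 rs C0 phi0 eta0 eta4 etaC D16 KL.
have lt16 : 1 / 16 < 2^-1 :> R by lra.
have eta1 : 1 - eta < 1 by lra.
have eta2 u : u <= 1 - eta -> [/\ 0 < 1 - u & eta <= 1 - u].
  by move=> h; split; lra.
have eta24 a1 a2 a3 :
    a3 <= a1 + a2 -> a1 < eta / 48 -> a2 < eta / 48 -> a3 < eta / 24.
  by move=> *; lra.
have half (u : R) : u <= 1 / 2 -> 1 / 2 <= 1 - u by move=> *; lra.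
have rR : 0 < r%:R :> R by rewrite ltr0n.
have mR : 4 <= m%:R :> R by rewrite (ler_nat _ 4).
have m0 : 0 < m%:R :> R by exact: lt_le_trans mR.
have m1 : 1 <= m%:R :> R by apply: le_trans mR; rewrite ler1n.
have m22 : 2 ^+ 2 <= m%:R :> R by rewrite -natrX.
apply: le_ereal_inf_tmp => _ [what mwhat <-].
pose w (f : {ffun 'I_r -> 'I_m}) := spiked_weights z0 idx eta f.
pose b0 := truth e (coef phi (@spike R K z0 eta)).
pose b f := truth e (coef phi (w f)).
pose P0 := iid_prob (regression_law b0) n.
pose P f := iid_prob (regression_law (b f)) n.
pose A f := [set z | norm1 (what z - w f) < eta / 48].
have mA f : measurable (A f).
  have := measurable_norm1_sub (w f) mwhat.
  move=> /(_ measurableT _ (measurable_itv `]-oo, (eta / 48)[)).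
  by rewrite setTI; congr measurable.
pose D := phi ^+ 2 * eta ^+ 2 / r%:R.
(* [V] is the fourth root of the number m^r of codewords and also the bound of [card_ball_le]. *)
pose l : R := r%:R * ln m%:R / 4.
pose V := expR l.
have V0 : 0 < V by exact: expR_gt0.
have V4 : V ^+ 4 = m%:R ^+ r.
  by rewrite /V -expRM_natl /l mulrC divfK// expRM_natl lnK ?posrE.
have V2 : 2 <= V ^+ 2.
  rewrite -(@ler_pXn2r _ 2) ?nnegrE ?exprn_ge0 ?(ltW V0)// -exprM V4.
  by apply: (le_trans m22); rewrite -[leLHS]expr1 ler_weXn2l.
pose c := 9 / 20 * V ^+ 3.
pose k := V ^+ 2 / 100 / (4 * (c - 1)).
have [c1 ck] := testing_error_le V0 V2 (lexx _).
have card_code : #|{ffun 'I_r -> 'I_m}|%:R = V ^+ 4 :> R.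
  by rewrite card_ffun !card_ord natrX V4.
have Pk f S : measurable S -> fine (P f S) <= c * fine (P0 S) + k.
  move=> mS.
  have Db : \sum_j (b f j 0 - b0 j 0) ^+ 2 <= D.
    by rewrite truth_dist//; exact: coef_spiked_weights_dist.
  have D0 : 0 <= \sum_j (b f j 0 - b0 j 0) ^+ 2.
    by apply: sumr_ge0 => j _; exact: sqr_ge0.
  have Dlt : \sum_j (b f j 0 - b0 j 0) ^+ 2 < 2^-1.
    by apply: (le_lt_trans Db); exact: le_lt_trans lt16.
  have := @chi2_change_of_measure _ _ _ _ _ _ (measurable_gaussian_lr b0 (b f))
    (fun=> expR_ge0 _) (@ge0_integral_gaussian_lr _ _ b0 (b f)) n _ c S
    (integral_gaussian_lr_sqr Dlt) c1 mS.
  move/le_trans; apply; rewrite lerD2l /k ler_wpM2r//.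
    by rewrite invr_ge0 mulr_ge0// subr_ge0 ltW.
  exact: (chi2_le m4 D0 Db D16 KL).
(* If the estimate is close to the weights of some g, any other f close to it satisfies 24 * dist f
   g < r, by the triangle inequality. *)
have zB z : \sum_f \1_(A f) z <= V.
  have [[g /set_mem gz]|nog] := pselect (exists g, z \in A g); last first.
    rewrite big1 ?(ltW V0)// => f _; rewrite indicE.
    by case: (boolP (z \in A f)) => // zf; case: nog; exists f.
  apply: le_trans (@card_ball_le R _ _ g m4).
  rewrite -sumr_const [leRHS]big_mkcond /=; apply: ler_sum => f _.
  rewrite inE indicE; case: (boolP (z \in A f)) => [/set_mem fz|_]; last first.
    by case: ifP.
  rewrite ifT//.
  have := norm1_spiked_weights idx_inj idx_z0 eta0 r0 f g.
  move=> /le_trans /(_ (norm1_triangle (what z) _ _)) h.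
  have {h} : eta / r%:R * (dist f g)%:R < eta / 24.
    exact: (eta24 _ _ _ h fz gz).
  rewrite -mulrA ltr_pM2l// mulrC ltr_pdivrMr// mulrC ltr_pdivlMr//.
  rewrite -natrM ltr_nat mulnC.
  exact: ltnW.
have [] := @exists_unlikely _ _ R _ P0 P A c k V _ _ mA Pk zB.
- by rewrite card_ffun !card_ord expn_gt0 (leq_trans _ m4).
- by rewrite (le_trans _ (ltW c1)).
rewrite card_code => f /le_trans /(_ ck) Pf.
apply: (@le_trans _ _ (P f (~` A f))).
  rewrite probability_setC// -(fineK (fin_num_measure (P f) _ (mA f))).
  by rewrite -EFinB lee_fin; exact: half.
apply: ereal_sup_ubound; exists (regression_law (b f)), (P f), (w f); split.
- apply: model_class_diag => //.
  + exact: weights_spiked_weights.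
  + move=> i; apply: le_lt_trans eta1.
    exact: (spiked_weights_le_spike idx_inj idx_z0 eta0 eta4 r0 f i).
  + by rewrite (leq_trans (norm0_spiked_weights _ _ _ _)).
  + exact: ltW.
  + move=> i.
    have h := spiked_weights_le_spike idx_inj idx_z0 eta0 eta4 r0 f i.
    have [u0 etau] := eta2 _ h.
    rewrite /coef exprMn exprVn sqr_sqrtr ?(ltW u0)//.
    by apply: le_trans etaC; rewrite ler_wpM2l ?sqr_ge0// lef_pV2 ?posrE.
- exact: iid_law_iid_prob.
- congr (P f _); apply/seteqP; split=> z /=; rewrite /A /=.
    by move/negP; rewrite -leNgt.
  by move=> h; apply/negP; rewrite -leNgt.
Qed.

End LowerBound.

(** One coordinate is set aside for the spike, and r < s leaves room for it in the support. K <= m s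
    gives log(K/s) <= log m, s <= 3r trades s for r, and 4 <= m is for [card_ball_le]. *)
Lemma block_sizes (K s : nat) (r := s./2) (m := (K.-1 %/ r)%N) :
  (2 <= s)%N -> (5 * s <= 2 * K)%N ->
  [/\ (0 < r)%N, (r < s)%N, (s <= 3 * r)%N, (4 <= m)%N & (K <= m * s)%N].
Proof.
move=> s2 sK.
have sr : (2 * r <= s <= (2 * r).+1)%N.
  rewrite -[in X in (_ <= X <= _)%N](odd_double_half s) -/r.
  by case: (odd s); lia.
move: sr; have r0 : (0 < r)%N by rewrite half_gt0.
have h : (K.-1 < m.+1 * r)%N by exact: ltn_ceil.
have m4 : (4 <= m)%N.
  rewrite leq_divRL//; have := odd_double_half s; rewrite -/r.
  by case: (odd s); lia.
move: (r) (m) r0 h m4 => r' m' r0 h m4 /andP[rs1 rs2].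
by split=> //; nia.
Qed.

Lemma block_index_lt (K r m i j : nat) : (m * r <= K.-1)%N -> (0 < K)%N ->
  (i < r)%N -> (j < m)%N -> ((i * m + j).+1 < K)%N.
Proof.
move=> mr K0 ir jm.
have : (i.+1 * m <= r * m)%N by rewrite leq_mul2r ir orbT.
by rewrite mulSn mulnC; move: mr; rewrite mulnC; lia.
Qed.

(** A cap [M] on the rate is natural: two weight vectors are at l1-distance at most 2, so no lower
    bound can hold once [C * rate] exceeds 2. *)
Theorem theorem5 (R : realType) (C' M : R) (hC' : 0 < C') (hM : 0 < M) :
  exists c C : R, [/\ 0 < c, 0 < C &
    forall p K : nat, (K <= p)%N ->
    exists A : 'I_K -> {set 'I_p},
      (forall k l, k != l -> A k :&: A l = finset.set0) /\
      forall (n s : nat) (phin : R),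
        (0 < n)%N -> 0 < phin ->
        (2 <= s)%N -> s%:R <= 2 / 5 * K%:R :> R ->
        phin ^+ 2 <= c * (s%:R ^+ 2 * ln (K%:R / s%:R) / n%:R) `^ (1 / 3) ->
        rate n K s phin <= M ->
        ((1 / 2)%:E <=
           minimax_prob n sqloss A C' s phin (C * rate n K s phin))%E].
Proof.
(* The perturbed mass will be eta = C0 * rate: 1/90 makes the chi-square divergence small, and
   1/(4M) gives eta <= 1/4. *)
pose C0 : R := Num.min (1 / 90) ((4 * M)^-1).
have C0_gt0 : 0 < C0.
  by rewrite lt_min; apply/andP; split; [lra|rewrite invr_gt0 mulr_gt0].
have C0_le : C0 <= 1 / 90 by rewrite ge_min lexx.
have C0M : C0 * M <= 1 / 4.
  apply: (@le_trans _ _ ((4 * M)^-1 * M)).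
    by rewrite ler_wpM2r ?(ltW hM)// ge_min lexx orbT.
  by rewrite invfM -mulrA mulVf ?gt_eqF// mulr1 div1r.
(* The entry 1 gives c^3 <= c; the second bounds the largest coefficient by C', the third gives
   phi^2 <= 1. *)
pose c : R := Num.min 1 (Num.min (C' ^+ 4 * C0 ^+ 2) ((M ^+ 2)^-1)).
have c_gt0 : 0 < c by rewrite !lt_min ltr01 mulr_gt0 ?invr_gt0 ?exprn_gt0.
have c_le1 : c <= 1 by rewrite ge_min lexx.
have c3 : c ^+ 3 <= c by rewrite exprS ler_piMr ?(ltW c_gt0)// exprn_ile1// ltW.
have c3C : c ^+ 3 <= C' ^+ 4 * C0 ^+ 2.
  by apply: (le_trans c3); rewrite !ge_min lexx orbT.
have c3M : c ^+ 3 * M ^+ 2 <= 1.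
  rewrite -ler_pdivlMr ?exprn_gt0// div1r.
  by apply: (le_trans c3); rewrite !ge_min lexx !orbT.
exists c, (C0 / 48); split=> //; first by rewrite divr_gt0.
move=> p K Kp; exists (fun k => [set widen_ord Kp k]%SET); split.
  move=> k l kl; apply/setP => j; rewrite !inE.
  apply/negP => /andP[/eqP -> /eqP /(congr1 val) /= /val_inj klE].
  by rewrite klE eqxx in kl.
move=> n s phi n0 phi0 s2 sK phic rateM.
have nR : 0 < n%:R :> R by rewrite ltr0n.
have sR : 0 < s%:R :> R by rewrite ltr0n (leq_trans _ s2).
have sKn : (5 * s <= 2 * K)%N.
  rewrite -(ler_nat R) !natrM; lra.
pose r := s./2; pose m := (K.-1 %/ r)%N.
have [r0 rs s3r m4 Ksm] := block_sizes s2 sKn.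
rewrite -/r -/m in r0 rs s3r m4 Ksm.
have mr : (m * r <= K.-1)%N by exact: leq_trunc_div.
have K0 : (0 < K)%N by rewrite -(ltr_nat R); lra.
(* Blocks are consecutive; the successor reserves index 0 for the spike [z0]. *)
have idxP (i : 'I_r) (j : 'I_m) : ((i * m + j).+1 < K)%N.
  exact: block_index_lt mr K0 (ltn_ord i) (ltn_ord j).
pose idx i j := Ordinal (idxP i j).
pose z0 := Ordinal K0.
have idx_inj i j i' j' : idx i j = idx i' j' -> i = i' /\ j = j'.
  move=> /(congr1 val) /= [E].
  have Ei : i = i' :> nat.
    have := congr1 (fun x => x %/ m)%N E.
    by rewrite !divnMDl ?(leq_trans _ m4)// !divn_small// !addn0.
  split; apply: val_inj => //=.
  by move: E; rewrite Ei => /addnI.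
have idx_z0 i j : idx i j != z0 by [].
pose L0 : R := ln (K%:R / s%:R).
have Ks1 : 1 < K%:R / s%:R :> R by rewrite ltr_pdivlMr// mul1r; lra.
have L0_gt0 : 0 < L0 by exact: ln_gt0.
have L0m : L0 <= ln m%:R.
  rewrite ler_ln ?posrE; last 2 first.
  - exact: lt_trans Ks1.
  - by rewrite ltr0n (leq_trans _ m4).
  by rewrite ler_pdivrMr// -natrM ler_nat.
pose tau : R := s%:R ^+ 2 * L0 / n%:R.
have tau0 : 0 < tau by rewrite divr_gt0// mulr_gt0// exprn_gt0.
have phi20 : 0 < phi ^+ 2 by rewrite exprn_gt0.
pose rt := rate n K s phi.
have rt2 : rt ^+ 2 * phi ^+ 2 = tau.
  rewrite /rt /rate exprMn sqr_sqrtr -/L0; last first.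
    by rewrite divr_ge0 ?mulr_ge0 ?(ltW L0_gt0) ?(ltW phi0).
  rewrite /tau; field.
  by rewrite !gt_eqF.
have rt0 : 0 < rt.
  by rewrite /rt /rate mulr_gt0// sqrtr_gt0 divr_gt0// mulr_gt0//.
(* The hypothesis on phi, cubed. As tau = rt^2 phi^2, dividing by phi^2 gives phi^4 <= c^3 rt^2, the
   form used for [phi1] and [phiC]. *)
have phi6 : (phi ^+ 2) ^+ 3 <= c ^+ 3 * tau.
  have tau3 : tau = (tau `^ (1 / 3)) ^+ 3.
    rewrite -powR_mulrn ?powR_ge0// -powRrM.
    have -> : 1 / 3 * 3%:R = 1 :> R by field.
    by rewrite powRr1// ltW.
  by rewrite [X in _ <= _ * X]tau3 -exprMn lerXn2r// nnegrE ?(ltW phi20)//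
    mulr_ge0 ?powR_ge0// ltW.
have rtM2 : rt ^+ 2 <= M ^+ 2 by rewrite lerXn2r// nnegrE ltW.
pose eta := C0 * rt.
have eta0 : 0 < eta by exact: mulr_gt0.
have eta4 : eta <= 1 / 4.
  by apply: (le_trans _ C0M); rewrite ler_wpM2l// ltW.
have phi1 : phi ^+ 2 <= 1.
  rewrite -(@ler_pXn2r _ 2) ?nnegrE ?(ltW phi20)// expr1n.
  apply: (le_trans _ c3M); rewrite -(ler_pM2r phi20) -exprSr (le_trans phi6)//.
  by rewrite -rt2 mulrA ler_wpM2r ?(ltW phi20)// ler_wpM2l// exprn_ge0// ltW//.
have phiC : phi ^+ 2 / eta <= C' ^+ 2.
  have C2eta : 0 <= C' ^+ 2 * eta by exact: (mulr_ge0 (sqr_ge0 _) (ltW eta0)).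
  rewrite ler_pdivrMr// -(@ler_pXn2r _ 2) ?nnegrE ?(ltW phi20)//.
  rewrite -(ler_pM2r phi20) -exprSr (le_trans phi6)//.
  have -> : (C' ^+ 2 * eta) ^+ 2 * phi ^+ 2 = C' ^+ 4 * C0 ^+ 2 * tau.
    by rewrite -rt2 /eta; ring.
  by rewrite ler_wpM2r// ltW.
have rR : 0 < r%:R :> R by rewrite ltr0n.
have s3rR : s%:R <= 3 * r%:R :> R by rewrite -natrM ler_nat.
have D16 : phi ^+ 2 * eta ^+ 2 / r%:R <= 1 / 16.
  rewrite ler_pdivrMr//.
  have : eta ^+ 2 <= 1 / 16.
    have -> : 1 / 16 = (1 / 4) ^+ 2 :> R by field.
    by rewrite lerXn2r// nnegrE ?divr_ge0// ltW.
  have : 1 <= r%:R :> R by rewrite ler1n.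
  move: (phi ^+ 2) (eta ^+ 2) (r%:R : R) phi20 phi1 (sqr_ge0 eta) => x y z; nra.
(* Both n and phi cancel, leaving (C0 s)^2 L0 / r; here C0 s <= 3r / 90 = r / 30 and 1/900 <=
   1/800. *)
have KL : n%:R * (phi ^+ 2 * eta ^+ 2 / r%:R) <= r%:R * ln m%:R / 800.
  have -> : n%:R * (phi ^+ 2 * eta ^+ 2 / r%:R) = (C0 * s%:R) ^+ 2 * L0 / r%:R.
    have -> : phi ^+ 2 * eta ^+ 2 = C0 ^+ 2 * tau by rewrite -rt2 /eta; ring.
    rewrite /tau; field.
    by rewrite !gt_eqF.
  have Cs : (C0 * s%:R) ^+ 2 <= r%:R ^+ 2 / 800.
    apply: (@le_trans _ _ ((r%:R / 30) ^+ 2)).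
      rewrite lerXn2r ?nnegrE ?divr_ge0//; first by rewrite mulr_ge0 ?ltW.
      apply: (@le_trans _ _ (1 / 90 * (3 * r%:R))); last by lra.
      by rewrite ler_pM ?(ltW C0_gt0) ?(ltW sR).
    by rewrite exprMn ler_wpM2l ?sqr_ge0//; lra.
  rewrite ler_pdivrMr//.
  apply: (@le_trans _ _ (r%:R ^+ 2 / 800 * ln m%:R)).
    by rewrite ler_pM ?sqr_ge0 ?(ltW L0_gt0).
  by rewrite le_eqVlt; apply/orP; left; apply/eqP; field.
rewrite -/rt mulrAC -[C0 * rt]/eta.
apply: (minimax_prob_ge_half (idx := idx) (z0 := z0)) => //.
by move=> i j /(congr1 val) /= /val_inj.
Qed.
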